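(* Let $k$ be an algebraically closed field of characteristic $p>0$. In the set of pairs $(\mathbb{A}_k^N,\mathfrak a^e)$, $\mathfrak a^e=\mathfrak a_1^{e_1}\cdots\mathfrak a_s^{e_s}$, such that all $\mathfrak a_i$ are monomial ideals, Mustaţă–Nakamura's conjecture and the ACC conjecture hold. That is, for every $N\ge1$: (1) for every finite subset $e\subset\mathbb{R}_{>0}$ there is a positive integer $\ell_{N,e}$ (depending on $N$ and $e$) such that for every multiideal $\mathfrak a^e$ on $\mathbb{A}_k^N$ with exponent $e$ and with all $\mathfrak a_i$ monomial ideals, there is a prime divisor $E$ over $\mathbb{A}_k^N$ that computes $\mathrm{mld}(0;\mathbb{A}_k^N,\mathfrak a^e)$ and satisfies $k_E\le\ell_{N,e}$; (2) for every DCC set $J\subset\mathbb{R}_{>0}$, the set $$\{\mathrm{mld}(0;\mathbb{A}_k^N,\mathfrak a^e)\mid e\subset J,\ \text{all } \mathfrak a_i \text{ monomial ideals},\ (\mathbb{A}_k^N,\mathfrak a^e)\text{ is log canonical at }0\}$$ satisfies the ascending chain condition.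
   Context: Let $A=\mathbb{A}_k^N=\operatorname{Spec}k[X_1,\dots,X_N]$, with origin $0$. A pair $(A,\mathfrak a^e)$ consists of $A$ and a multiideal $\mathfrak a^e=\mathfrak a_1^{e_1}\cdots\mathfrak a_s^{e_s}$ with exponent $e=\{e_1,\dots,e_s\}\subset\mathbb{R}_{>0}$ a finite set, where $\mathfrak a_1,\dots,\mathfrak a_s$ are ideals of $k[X_1,\dots,X_N]$. A monomial ideal is an ideal generated by monomials in $X_1,\dots,X_N$. A prime divisor $E$ over $A$ is a prime divisor on some normal $A'$ with a birational morphism $A'\to A$; $\mathrm{val}_E$ is the corresponding valuation and $k_E$ is the coefficient at $E$ of the relative canonical divisor $K_{A'/A}$. The log discrepancy is $a(E;A,\mathfrak a^e)=k_E-\sum_i e_i\,\mathrm{val}_E(\mathfrak a_i)+1$. The pair is log canonical at $0$ if $a(E;A,\mathfrak a^e)\ge0$ for every prime divisor $E$ over $A$ whose center contains $0$. For $N\ge 2$, $\mathrm{mld}(0;A,\mathfrak a^e)=\inf\{a(E;A,\mathfrak a^e)\mid E \text{ a prime divisor over } A \text{ with center } 0\}$. For $N=1$ it is defined by the same formula if the right-hand side is non-negative, and is $-\infty$ otherwise. A prime divisor $E$ over $A$ with center $\{0\}$ computes $\mathrm{mld}(0;A,\mathfrak a^e)$ if $a(E;A,\mathfrak a^e)=\mathrm{mld}(0;A,\mathfrak a^e)$ when $\mathrm{mld}(0;A,\mathfrak a^e)\ge 0$, and if $a(E;A,\mathfrak a^e)<0$ when $\mathrm{mld}(0;A,\mathfrak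 a^e)=-\infty$. A set of real numbers is a DCC set if it contains no infinite strictly decreasing sequence, and satisfies the ascending chain condition (ACC) if it contains no infinite strictly increasing sequence. *)

(* Defs.v *)
From HB Require Import structures.
From mathcomp Require Import all_boot all_order all_algebra.
From mathcomp Require Import mpoly.
From mathcomp Require Import boolp classical_sets cardinality reals.
From mathcomp Require Import constructive_ereal ereal.
From mathcomp Require Import ring.

Set Implicit Arguments.
Unset Strict Implicit.
Unset Printing Implicit Defensive.

Import Order.TTheory GRing.Theory Num.Theory.

Local Open Scope classical_set_scope.
Local Open Scope ring_scope.

Definition dcc {d : Order.disp_t} {T : porderType d} (S : set T) : Prop :=
  ~ exists u : nat -> T, forall n, S (u n) /\ (u n.+1 < u n)%O.

Definition acc {d : Order.disp_t} {T : porderType d} (S : set T) : Prop :=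
  ~ exists u : nat -> T, forall n, S (u n) /\ (u n < u n.+1)%O.

Notation funfield k N := {fraction {mpoly k[N]}}.

Notation "f %:F" := (@FracField.tofrac _ f) : ring_scope.

Definition is_ideal {A : comNzRingType} (I : set A) : Prop :=
  [/\ I 0, forall f g, I f -> I g -> I (f + g)
    & forall f g, I g -> I (f * g)].

Definition monomial_ideal {k : fieldType} {N : nat}
    (I : set {mpoly k[N]}) : Prop :=
  exists M : set 'X_{1..N},
    I = smallest is_ideal [set 'X_[m] | m in M].

Definition origin_ideal (k : fieldType) (N : nat) : set {mpoly k[N]} :=
  [set f | f.@[fun=> 0] = 0].
Arguments origin_ideal k N : clear implicits.

Lemma frac_reprE (A : idomainType) (x : {fraction A}) :
  x = (\n_(repr x))%:F / (\d_(repr x))%:F.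
Proof.
have d0 : (\d_(repr x))%:F != 0 :> {fraction A}.
  by rewrite tofrac_eq0 denom_ratioP.
apply: (mulIf d0); rewrite mulfVK//.
rewrite -[in LHS](reprK x); set r := repr x; unlock FracField.tofrac.
rewrite -[LHS]FracField.pi_mul; apply/eqmodP => /=.
have r0 := denom_ratioP r.
rewrite /FracField.mulf FracField.equivfE.
rewrite !numden_Ratio ?mulr1 ?oner_neq0//.
by rewrite reprK -/r mulrC.
Qed.

(* The extension of d/dX_i to the function field by the quotient rule, on the
   fraction chosen by [repr]; [fderivE] is independence of that choice. *)
Definition fderiv {k : fieldType} {N : nat} (i : 'I_N) (x : funfield k N) :
    funfield k N :=
  let a := \n_(repr x) in let b := \d_(repr x) in
  (a^`M(i) * b - a * b^`M(i))%:F / (b ^+ 2)%:F.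

Lemma fderivE (k : fieldType) (N : nat) (i : 'I_N) (a b : {mpoly k[N]}) :
  b != 0 ->
  fderiv i (a%:F / b%:F) = (a^`M(i) * b - a * b^`M(i))%:F / (b ^+ 2)%:F.
Proof.
move=> b0; rewrite /fderiv /=.
have := frac_reprE (a%:F / b%:F).
have := denom_ratioP (repr (a%:F / b%:F)).
move: (\n_(repr _)) (\d_(repr _)) => c d d0 rE.
have ad : a * d = c * b.
  by apply/eqP; rewrite -tofrac_eq !tofracM -eqr_div ?tofrac_eq0// rE.
have : (a * d)^`M(i) = (c * b)^`M(i) by rewrite ad.
rewrite !mderivM.
move: (a^`M(i)) (b^`M(i)) (c^`M(i)) (d^`M(i)) => a' b' c' d' dad.
apply/eqP; rewrite eqr_div ?tofrac_eq0 ?expf_neq0//.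
rewrite -!tofracM tofrac_eq; apply/eqP.
have -> : (c' * d - c * d') * b ^+ 2 =
    (c' * b + c * b') * (d * b) - (c * b) * (b' * d) - (c * b) * (d' * b).
  by ring.
by rewrite -dad -ad; ring.
Qed.

Definition jacobian {k : fieldType} {N : nat} (f : 'I_N -> funfield k N) :
    funfield k N :=
  \det (\matrix_(i < N, j < N) fderiv j (f i)).

Definition gen_subalg {k : fieldType} {N n : nat} (y : 'I_n -> funfield k N) :
    set (funfield k N) :=
  [set mmap (fun c : k => (c%:MP : {mpoly k[N]})%:F) y q
    | q in [set: {mpoly k[n]}]].

Definition integrally_closed {K : fieldType} (B : set K) : Prop :=
  forall (q : {poly K}) (x : K),
    q \is monic -> (forall i, B q`_i) -> root q x -> B x.

Definition prime_ideal_of {K : fieldType} (B P : set K) : Prop :=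
  [/\ P `<=` B, P 0 /\ ~ P 1,
      forall x y, P x -> P y -> P (x + y),
      forall x y, B x -> P y -> P (x * y)
    & forall x y, B x -> B y -> P (x * y) -> P x \/ P y].

Definition height_one {K : fieldType} (B P : set K) : Prop :=
  P <> [set 0] /\
  forall Q, prime_ideal_of B Q -> Q `<=` P -> Q = [set 0] \/ Q = P.

Definition localization {K : fieldType} (B P : set K) : set K :=
  [set x | exists a b, [/\ B a, B b, ~ P b & x = a / b]].

(* [v] is the normalized discrete valuation with valuation ring [O];
   the value [v 0] is not constrained and never used. *)
Definition discrete_valuation_of {K : fieldType} (O : set K) (v : K -> int) :
    Prop :=
  [/\ forall x y, x != 0 -> y != 0 -> v (x * y) = v x + v y,
      forall x y, x != 0 -> y != 0 -> x + y != 0 ->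
        Num.min (v x) (v y) <= v (x + y),
      exists2 t, t != 0 & v t = 1
    & forall x, x != 0 -> (0 <= v x <-> O x)].

(* A prime divisor over A^N.  The order along E, k_E and the center depend only
   on the local ring of the model A' at the generic point of E, so A' is
   replaced by an affine open subset meeting E: the spectrum of a finitely
   generated normal k-subalgebra of k(X_1, ..., X_N) containing the X_i.  E is
   then a prime of height one, and its local ring, being one-dimensional and
   normal, is the ring of a unique normalized discrete valuation. *)
Record prime_divisor (k : fieldType) (N : nat) := PrimeDivisor {
  pd_ngen : nat;
  pd_gen : 'I_pd_ngen -> funfield k N;
  pd_prime : set (funfield k N);
  pd_ord : funfield k N -> int;
  pd_dominates : forall i : 'I_N, gen_subalg pd_gen ('X_i)%:F;
  pd_normal : integrally_closed (gen_subalg pd_gen);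
  pd_primeP : prime_ideal_of (gen_subalg pd_gen) pd_prime;
  pd_height_one : height_one (gen_subalg pd_gen) pd_prime;
  pd_ordP :
    discrete_valuation_of (localization (gen_subalg pd_gen) pd_prime) pd_ord
}.

Definition local_ring {k : fieldType} {N : nat} (E : prime_divisor k N) :
    set (funfield k N) :=
  localization (gen_subalg (pd_gen (p := E))) (pd_prime E).

(* The prime of k[X_1, ..., X_N] which is the generic point of the center. *)
Definition center_ideal {k : fieldType} {N : nat} (E : prime_divisor k N) :
    set {mpoly k[N]} :=
  [set f | pd_prime E f%:F].

Definition center_contains_origin {k : fieldType} {N : nat}
    (E : prime_divisor k N) : Prop :=
  center_ideal E `<=` origin_ideal k N.

Definition center_is_origin {k : fieldType} {N : nat}
    (E : prime_divisor k N) : Prop :=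
  center_ideal E = origin_ideal k N.

(* k_E is the order along E of the rational form dX_1 /\ ... /\ dX_N.  For k
   perfect, the module of top forms of the local ring O of E is free of rank
   one, and spanned inside k(X) dX_1 /\ ... /\ dX_N by the forms
     df_1 /\ ... /\ df_N = jacobian f dX_1 /\ ... /\ dX_N,   f_i in O.
   Hence it is generated by such a form with [jacobian f] of least order, and
   k_E is the opposite of that order. *)
Definition is_discrepancy {k : fieldType} {N : nat}
    (E : prime_divisor k N) (n : int) : Prop :=
  (forall f : 'I_N -> funfield k N, (forall i, local_ring E (f i)) ->
     jacobian f != 0 -> - n <= pd_ord E (jacobian f)) /\
  exists f : 'I_N -> funfield k N,
    [/\ forall i, local_ring E (f i), jacobian f != 0
      & pd_ord E (jacobian f) = - n].

Definition discrepancy {k : fieldType} {N : nat} (E : prime_divisor k N) :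
    int :=
  xget 0 [set n | is_discrepancy E n].

Record multiideal (R : realType) (k : fieldType) (N : nat) := Multiideal {
  mi_size : nat;
  mi_exp : 'I_mi_size -> R;
  mi_ideal : 'I_mi_size -> set {mpoly k[N]};
  mi_exp_gt0 : forall i, 0 < mi_exp i;
  mi_idealP : forall i, is_ideal (mi_ideal i)
}.

(* Exponents are indexed, so they may repeat; e = {e_1, ..., e_s} is an equality
   of sets.  Repetitions can be merged: a^c b^c has the same discrepancies as
   (a b)^c. *)
Definition exponents {R : realType} {k : fieldType} {N : nat}
    (a : multiideal R k N) : set R :=
  range (mi_exp (m := a)).

Definition monomial_multiideal {R : realType} {k : fieldType} {N : nat}
    (a : multiideal R k N) : Prop :=
  forall i, monomial_ideal (mi_ideal (m := a) i).

(* The order of the zero ideal is +oo, as the infimum of the empty set. *)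
Definition ideal_val (R : realType) {k : fieldType} {N : nat}
    (E : prime_divisor k N) (I : set {mpoly k[N]}) : \bar R :=
  ereal_inf [set ((pd_ord E f%:F)%:~R)%:E | f in I `\ 0].

Definition log_discrepancy {R : realType} {k : fieldType} {N : nat}
    (E : prime_divisor k N) (a : multiideal R k N) : \bar R :=
  (((discrepancy E)%:~R)%:E
   - \sum_(i < mi_size a) (mi_exp i)%:E * ideal_val R E (mi_ideal i) + 1%:E)%E.

Definition log_canonical_at_origin {R : realType} {k : fieldType} {N : nat}
    (a : multiideal R k N) : Prop :=
  forall E : prime_divisor k N, center_contains_origin E ->
    (0 <= log_discrepancy E a)%E.

Definition mld {R : realType} {k : fieldType} {N : nat}
    (a : multiideal R k N) : \bar R :=
  let m := ereal_inf [set log_discrepancy E a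
                     | E in [set E : prime_divisor k N | center_is_origin E]] in
  if (N == 1)%N && (m < 0)%E then -oo%E else m.

Definition computes_mld {R : realType} {k : fieldType} {N : nat}
    (E : prime_divisor k N) (a : multiideal R k N) : Prop :=
  center_is_origin E /\
  (((0 <= mld a)%E /\ log_discrepancy E a = mld a) \/
   (mld a = -oo%E /\ (log_discrepancy E a < 0)%E)).

(* Main.v *)
(* The proof is characteristic free.  Along a divisor E centered at 0, a monomial
   ideal has order min <w, m>, where w = (ord_E X_i) and m runs over its exponents.
   Since dX_1/X_1 /\ ... /\ dX_N/X_N has at most a simple pole along E,
   k_E + 1 >= |w|, with equality for the toric divisor of a primitive weight w.
   So the mld is the infimum over positive integral weights of the homogeneous
   convex piecewise linear function A(w) = |w| - sum_i e_i min <w, m>, or -oo if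
   this function takes a negative value.

   Both statements follow by compactness.  Along an ultrafilter, a sequence of
   multiideals has a limit: an exponent belongs to the limit ideal if it belongs to
   almost all terms.  The limit ideal is finitely generated, hence contained in
   almost all terms, and its order along any fixed weight is that of almost all
   terms.  By Dickson's lemma the limit function A attains its minimum; the
   minimizing weight then computes the mld of almost all terms, which gives (1).
   If the exponents vary in a DCC set, their limits bound them from above almost
   everywhere, so the limit function A is below almost all terms and is also their
   pointwise limit, which excludes a strictly increasing sequence of mlds, and
   gives (2). *)
Require Import Defs.
From HB Require Import structures.
From mathcomp Require Import all_boot all_order all_algebra.
From mathcomp Require Import mpoly.
From mathcomp Require Import boolp classical_sets cardinality reals.
From mathcomp Require Import constructive_ereal ereal.
From mathcomp Require Import perm filter.
From mathcomp Require Import zify ring lra.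

Set Implicit Arguments.
Unset Strict Implicit.
Unset Printing Implicit Defensive.

Import Order.TTheory GRing.Theory Num.Theory.

Local Open Scope classical_set_scope.
Local Open Scope ring_scope.

(** * Limits of monomial ideals along an ultrafilter *)

(** Since the exponents are real, nonnegativity of [A] alone does not make its infimum over integral
    weights a minimum: [|sqrt 2 w_1 - w_2|] is homogeneous, convex and piecewise linear, and its
    infimum 0 is not attained. What saves [A] is that its domains of linearity are cut out by
    integral forms, which is what Dickson's lemma exploits. A toric divisor exists only for a
    primitive weight. Division by the gcd keeps the sign of [A] and does not raise its nonnegative
    values, which is enough for minima. It is not enough for unboundedness when [A] takes a negative
    value: the multiples of one weight give no new divisor, so they must be perturbed, and in
    dimension one the value [-oo] is a convention. In characteristic p some entries of a weight may
    vanish in [k]. The Bezout relation [c.w = 1] survives reduction and takes the place of division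
    by a weight in the bound on Jacobians; over the integers it also yields the generators of the
    toric chart. *)

Lemma free_ultrafilter : exists U : set_system nat, UltraFilter U /\ \oo `<=` U.
Proof. exact: ultraFilterLemma. Qed.

Lemma ultra_ge (U : set_system nat) : \oo `<=` U ->
  forall n, U [set m | (n <= m)%N].
Proof. by move=> ooU n; apply: ooU; exists n. Qed.

Lemma ultraI (T : Type) (U : set_system T) (A B : set T) :
  UltraFilter U -> U A -> U B -> U (A `&` B).
Proof. by move=> UU; exact: filterI. Qed.

(** Pigeonhole: an ultrafilter selects one cell of a finite partition. *)
Lemma ultra_mem_seq (T : eqType) (U : set_system nat) (F : nat -> T)
    (s : seq T) :
  UltraFilter U -> U [set n | F n \in s] ->
  exists2 x, x \in s & U [set n | F n = x].
Proof.
move=> UU; elim: s => [|y s IH] Us.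
  by have [n] := filter_ex Us.
have [Uy|Uy] := in_ultra_setVsetC [set n | F n = y] UU.
  by exists y => //; rewrite mem_head.
have [|x xs Ux] := IH.
  by apply: filterS2 Uy Us => n /= ny; rewrite inE => /orP[/eqP|].
by exists x => //; rewrite inE xs orbT.
Qed.

Lemma ultra_forall_fin (T : Type) (I : finType) (U : set_system T)
    (P : I -> T -> Prop) : UltraFilter U ->
  (forall i, U [set n | P i n]) -> U [set n | forall i, P i n].
Proof.
move=> UU UP.
suff /(_ (enum I)) : forall s : seq I, U [set n | forall i, i \in s -> P i n].
  by apply: filterS => n Pn i; apply: Pn; rewrite mem_enum.
elim=> [|j s IH]; first by apply: filterS filterT => n _ i.
apply: filterS2 (UP j) IH => n /= Pj Ps i.
by rewrite inE => /orP[/eqP->|/Ps].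
Qed.

(** Along a free ultrafilter a coordinate is either almost always constant or almost always above
    any given bound. Hence for almost all [n], almost all [m] dominate [n] in every coordinate. *)
Lemma dickson (I : finType) (v : nat -> I -> nat) :
  exists n m, (n < m)%N /\ forall i, (v n i <= v m i)%N.
Proof.
have [U [UU ooU]] := free_ultrafilter.
have Ui i : U [set n | U [set m | (v n i <= v m i)%N]].
  have [[c Uc]|nUc] := pselect (exists c, U [set n | v n i = c]).
    apply: filterS (Uc) => n /= nc; apply: filterS Uc => m /= mc.
    by rewrite nc mc.
  apply: filterS filterT => n _.
  have [//|Un] := in_ultra_setVsetC [set m | (v n i <= v m i)%N] UU.
  have [|c _ Uc] := @ultra_mem_seq _ U (v ^~ i) (iota 0 (v n i)) UU.
    apply: filterS Un => m /= /negP.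
    by rewrite -ltnNge mem_iota add0n.
  by case: nUc; exists c.
have /filter_ex [n Un] := ultra_forall_fin UU Ui.
have /filter_ex [m [nm le]] :=
  ultraI UU (ultra_ge ooU n.+1) (ultra_forall_fin UU Un).
by exists n, m.
Qed.

(** If no finite [G] works, every finite part of [S] can be enlarged by a monomial divisible by none
    of its members; the infinite sequence so obtained contradicts [dickson]. *)
Lemma dickson_basis N (S : set 'X_{1..N}) :
  exists G : seq 'X_{1..N}, (forall m, m \in G -> S m) /\
    forall m, S m -> exists2 g, g \in G & (g <= m)%MM.
Proof.
apply: contrapT => nG.
pose good (G : seq 'X_{1..N}) := forall m, m \in G -> S m.
have next (G : {G | good G}) :
    exists m, S m /\ forall g, g \in sval G -> ~~ (g <= m)%MM.
  apply: contrapT => nm; apply: nG; exists (sval G); split; first exact: (svalP G).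
  move=> m Sm; apply: contrapT => ng; apply: nm; exists m; split=> // g gG.
  by apply/negP => gm; apply: ng; exists g.
have /boolp.choice[f fP] := next.
have goodS (G : {G | good G}) : good (f G :: sval G).
  by move=> m; rewrite inE => /orP[/eqP->|/(svalP G)//]; have [] := fP G.
have good0 : good [::] by [].
pose L := fix L n := if n is n'.+1 then exist good _ (goodS (L n'))
                     else exist good [::] good0.
have Lmem n m : (n < m)%N -> f (L n) \in sval (L m).
  elim: m => // m IH; rewrite ltnS leq_eqVlt => /orP[/eqP->|/IH h].
    by rewrite /= mem_head.
  by rewrite /= inE h orbT.
have [n [m [nm le]]] := dickson (fun n i => f (L n) i).
have [_ /(_ _ (Lmem _ _ nm)) /negP] := fP (L m).
by apply; apply/mnm_lepP.
Qed.

Definition wdot N (w : 'I_N -> nat) (m : 'X_{1..N}) : nat :=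
  (\sum_i w i * m i)%N.

Lemma wdotD N (w : 'I_N -> nat) m m' :
  wdot w (m + m')%MM = (wdot w m + wdot w m')%N.
Proof.
by rewrite /wdot -big_split; apply: eq_bigr => i _; rewrite mnmDE mulnDr.
Qed.

Lemma leq_wdot N (w : 'I_N -> nat) m m' :
  (m <= m')%MM -> (wdot w m <= wdot w m')%N.
Proof. by move=> /mnm_lepP le; apply: leq_sum => i _; rewrite leq_mul2l le orbT. Qed.

Lemma wdot_combl N (w u : 'I_N -> nat) t m :
  wdot (fun i => w i + t * u i)%N m = (wdot w m + t * wdot u m)%N.
Proof.
rewrite /wdot big_distrr -big_split; apply: eq_bigr => i _ /=.
by rewrite mulnDl mulnA.
Qed.

Lemma mdeg_le_wdot N (w : 'I_N -> nat) m :
  (forall i, 0 < w i)%N -> (mdeg m <= wdot w m)%N.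
Proof. by move=> w0; rewrite mdegE; apply: leq_sum => i _; rewrite leq_pmull. Qed.

(* [g w] is the order of the monomial ideal with exponents [S] along the toric
   divisor of weight [w]. *)
Definition least_weight N (S : set 'X_{1..N}) (g : ('I_N -> nat) -> nat) :=
  forall w, (forall m, S m -> g w <= wdot w m)%N /\
    exists2 m, S m & wdot w m = g w.

Lemma least_weight_exists N (S : set 'X_{1..N}) :
  S !=set0 -> exists g, least_weight S g.
Proof.
move=> [m0 Sm0].
suff /boolp.choice[g gP] : forall w, exists c, (forall m, S m -> c <= wdot w m)%N /\
    exists2 m, S m & wdot w m = c by exists g.
move=> w.
have ex : exists c, `[< exists2 m, S m & wdot w m = c >].
  by exists (wdot w m0); apply/asboolP; exists m0.
exists (ex_minn ex); case: ex_minnP => c /asboolP[m Sm mc] cmin; split.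
  by move=> m' Sm'; apply: cmin; apply/asboolP; exists m'.
by exists m.
Qed.

Lemma least_weight0 N : @least_weight N [set 0%MM] (fun=> 0%N).
Proof.
move=> w; split=> //; exists 0%MM => //.
by rewrite /wdot big1// => i _; rewrite mnm0E muln0.
Qed.

(** The order of a product of ideals is the sum of the orders. Through [least_weight_sum] this
    merges ideals carrying the same exponent. *)
Lemma least_weightD N (S T : set 'X_{1..N}) g h :
  least_weight S g -> least_weight T h ->
  least_weight [set (m + m')%MM | m in S & m' in T] (fun w => g w + h w)%N.
Proof.
move=> gP hP w; have [g1 [m Sm mg]] := gP w; have [h1 [m' Sm' mh]] := hP w.
split=> [_ [a Sa [b Tb <-]]|]; first by rewrite wdotD leq_add ?g1 ?h1.
by exists (m + m')%MM; [exists m => //; exists m'|rewrite wdotD mg mh].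
Qed.

Lemma least_weight_sum N (I : Type) (r : seq I) (P : pred I)
    (S : I -> set 'X_{1..N}) g :
  (forall i, least_weight (S i) (g i)) ->
  exists T, least_weight T (fun w => \sum_(i <- r | P i) g i w)%N.
Proof.
move=> gP; elim: r => [|i r [T TP]].
  exists [set 0%MM]; under [X in least_weight _ X]eq_fun do rewrite big_nil.
  exact: least_weight0.
have -> : (fun w => \sum_(j <- i :: r | P j) g j w)%N =
    if P i then (fun w => g i w + \sum_(j <- r | P j) g j w)%N
    else (fun w => \sum_(j <- r | P j) g j w)%N.
  by apply/funext => w; rewrite big_cons; case: (P i).
case: (P i); last by exists T.
by eexists; exact: least_weightD (gP i) TP.
Qed.

(** The bound at the weight (1, ..., 1) keeps the minimizing exponents from escaping to infinity, so
    the limit set is nonempty. Positivity of [w] in the last clause matters: the ideals [(x^n, y)]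
    have order 0 along the weight (0, 1), but their limit [(y)] has order 1. *)
Lemma least_weight_limit N (U : set_system nat) (S : nat -> set 'X_{1..N}) g C :
  UltraFilter U -> (forall n, least_weight (S n) (g n)) ->
  U [set n | g n (fun=> 1%N) <= C]%N ->
  exists T h, [/\ least_weight T h, U [set n | forall w, g n w <= h w]%N
    & forall w, (forall i, 0 < w i)%N -> U [set n | g n w = h w]].
Proof.
move=> UU gP UC.
pose T := [set m | U [set n | S n m]].
(* As [w] is positive, a monomial of weight at most [c] has degree at most [c]. Finitely many
   candidates remain, so one of them is the minimizer for almost all [n]. *)
have key w c : (forall i, 0 < w i)%N -> U [set n | g n w <= c]%N ->
    exists2 m, T m & (wdot w m <= c)%N.
  move=> w0 Uc.
  have /boolp.choice[f fP] n : exists m, S n m /\ wdot w m = g n w.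
    by have [_ [m]] := gP n w; exists m.
  have [|m _ Um] := @ultra_mem_seq _ U f
      [seq bmnm m | m <- enum {: 'X_{1..N < c.+1}}] UU.
    apply: filterS Uc => n /= gc; have [Sn fn] := fP n.
    have lt : (mdeg (f n) < c.+1)%N.
      by rewrite ltnS (leq_trans (mdeg_le_wdot _ w0))// fn.
    by apply/mapP; exists (BMultinom lt) => //; rewrite mem_enum.
  exists m; first by apply: filterS Um => n /= <-; have [] := fP n.
  have /filter_ex[n [/= gc fm]] := ultraI UU Uc Um.
  by rewrite -fm; have [_ ->] := fP n.
have [//|//|m Tm _] := key (fun=> 1%N) C.
have [h hP] := least_weight_exists (ex_intro _ m Tm).
have UT : U [set n | forall w, g n w <= h w]%N.
  have [G [GT Gle]] := dickson_basis T.
  have UG : U [set n | forall m, m \in G -> S n m].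
    elim: G GT {Gle} => [|a G IH] GT; first by apply: filterS filterT => n _.
    have Ua : T a by apply: GT; rewrite mem_head.
    have UG : U [set n | forall m, m \in G -> S n m].
      by apply: IH => b bG; apply: GT; rewrite inE bG orbT.
    by apply: filterS2 Ua UG => n /= Sa SG b; rewrite inE => /orP[/eqP->|/SG].
  apply: filterS UG => n /= SG w; have [_ [a Ta <-]] := hP w.
  have [b bG ba] := Gle a Ta; have [gle _] := gP n w.
  by apply: leq_trans (gle _ (SG _ bG)) (leq_wdot _ ba).
exists T, h; split=> // w w0.
(* Orders below [h w] along [U] would give, by [key], an element of [T] of weight less than [h w].
   The case [h w = 0] is apart because [(h w).-1] is then not smaller than [h w]. *)
have [h0|hpos] := eqVneq (h w) 0%N.
  by apply: filterS UT => n /(_ w); rewrite h0 leqn0 => /eqP.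
have [Ule|Ugt] := in_ultra_setVsetC [set n | g n w <= (h w).-1]%N UU.
  have [a Ta] := key w _ w0 Ule; have [/(_ _ Ta) hle _] := hP w.
  by move=> ale; have := leq_trans hle ale; case: (h w) hpos => //= j _; rewrite ltnn.
apply: filterS2 UT Ugt => n /= /(_ w) le /negP; rewrite -ltnNge => gt.
by apply/eqP; rewrite eqn_leq le; case: (h w) hpos gt.
Qed.

(* The log discrepancy of the toric divisor of weight [w]. *)
Definition toric_logdisc (R : realType) N M (c : 'I_M -> R)
    (g : 'I_M -> ('I_N -> nat) -> nat) (w : 'I_N -> nat) : R :=
  (\sum_i w i)%:R - \sum_j c j * (g j w)%:R.

(** * Minima and limits of toric log discrepancies *)

Lemma descending_seq (T : Type) (P : T -> Prop) (lt : T -> T -> Prop) :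
  (exists x, P x) -> (forall x, P x -> exists y, P y /\ lt y x) ->
  exists u : nat -> T, forall n, P (u n) /\ lt (u n.+1) (u n).
Proof.
move=> [x0 Px0] next.
have /boolp.choice[f fP] (x : {x | P x}) : exists y : {x | P x}, lt (sval y) (sval x).
  by have [y [Py yx]] := next _ (svalP x); exists (exist _ y Py).
exists (fun n => sval (iter n f (exist _ x0 Px0))) => n.
by split; [exact: svalP|rewrite iterS; exact: fP].
Qed.

Lemma ltn_homo_dec {d : Order.disp_t} (T : porderType d) (u : nat -> T) :
  (forall n, (u n.+1 < u n)%O) -> forall n m, (n < m)%N -> (u m < u n)%O.
Proof.
move=> dec n; elim=> // m IH; rewrite ltnS leq_eqVlt => /orP[/eqP->//|/IH].
exact: lt_trans (dec m).
Qed.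

(* On the ray from [w] through [w'] the excesses [<w, m> - g w] of the finitely
   many generators [m] vary linearly, so they stay nonnegative beyond [w'] as
   soon as they do not decrease from [w] to [w'].  Then [toric_logdisc] is
   bounded above on this ray by the affine function agreeing with it at [w] and
   [w'], whose slope must be nonnegative. *)
Lemma toric_logdisc_min (R : realType) N M (c : 'I_M -> R)
    (S : 'I_M -> set 'X_{1..N}) g :
  (forall j, 0 <= c j) -> (forall j, least_weight (S j) (g j)) ->
  (forall w, (forall i, 0 < w i)%N -> 0 <= toric_logdisc c g w) ->
  exists2 w, (forall i, 0 < w i)%N & forall w', (forall i, 0 < w' i)%N ->
    toric_logdisc c g w <= toric_logdisc c g w'.
Proof.
move=> c0 gP A0; apply: contrapT => nmin.
pose A := toric_logdisc c g.
have [||u uP] := @descending_seq ('I_N -> nat) (fun w => forall i, 0 < w i)%N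
    (fun w' w => A w' < A w).
- by exists (fun=> 1%N).
- move=> w w0; apply: contrapT => nw; apply: nmin; exists w => // w' w'0.
  by rewrite leNgt; apply/negP => lt; apply: nw; exists w'.
have upos n : (forall i, 0 < u n i)%N by have [] := uP n.
have /(ltn_homo_dec (u := A \o u)) Adec n : A (u n.+1) < A (u n) by have [] := uP n.
have /boolp.choice[G GP] j := dickson_basis (S j).
pose I : finType := ('I_N + {j : 'I_M & 'I_(size (G j))})%type.
pose gen (x : {j : 'I_M & 'I_(size (G j))}) := nth 0%MM (G (tag x)) (tagged x).
have genS x : S (tag x) (gen x).
  by have [+ _] := GP (tag x); apply; exact: mem_nth.
pose v n (i : I) := match i with
  | inl i => u n i
  | inr x => (wdot (u n) (gen x) - g (tag x) (u n))%N end.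
have [n [m [nm vle]]] := dickson v.
set w := u n; set w' := u m; pose d i := (w' i - w i)%N.
have dE i : w' i = (w i + 1 * d i)%N.
  by rewrite mul1n subnKC//; exact: (vle (inl i)).
(* Written without subtraction in [nat]: [g j (w + t d) >= g j w + t (g j w' - g j w)]. Each
   generator [a] satisfies [<d, a> >= g j w' - g j w], because its excess does not decrease from [w]
   to [w']. *)
have glin j t : (g j w + t * g j w' <= g j (fun i => w i + t * d i) + t * g j w)%N.
  have [_ [b Sb <-]] := gP j (fun i => w i + t * d i)%N.
  have [a aG ab] := (GP j).2 _ Sb.
  apply: (@leq_trans (wdot (fun i => w i + t * d i)%N a + t * g j w)); last first.
    by rewrite leq_add2r leq_wdot.
  have xP : (index a (G j) < size (G j))%N by rewrite index_mem.
  have := vle (inr (Tagged (fun j => 'I_(size (G j))) (Ordinal xP))).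
  rewrite /v /gen /= nth_index// -/w -/w'.
  have aS := (GP j).1 _ aG.
  have := (gP j w).1 _ aS; have := (gP j w').1 _ aS.
  rewrite (funext dE) !wdot_combl mul1n.
  move: (wdot w a) (wdot d a) (g j w) (g j _) => x y z z' h1 h2 h3.
  have : (z' <= y + z)%N by lia.
  nia.
have Alin t : A (fun i => w i + t * d i)%N <= A w + t%:R * (A w' - A w).
  rewrite /A /toric_logdisc (funext dE).
  have -> : (\sum_i (w i + 1 * d i) = \sum_i w i + \sum_i d i)%N.
    by rewrite -big_split; apply: eq_bigr => i _; rewrite mul1n.
  have -> : (\sum_i (w i + t * d i) = \sum_i w i + t * \sum_i d i)%N.
    by rewrite big_distrr -big_split.
  have : \sum_j c j * (g j w)%:R + t%:R * \sum_j c j * (g j w')%:R <=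
    \sum_j c j * (g j (fun i => w i + t * d i)%N)%:R
       + t%:R * \sum_j c j * (g j w)%:R.
    rewrite !mulr_sumr -!big_split; apply: ler_sum => j _ /=.
    rewrite !(mulrCA t%:R) -!mulrDr ler_wpM2l//.
    by rewrite -!natrM -!natrD ler_nat.
  rewrite -(funext dE) !natrD natrM.
  move: (\sum_j c j * (g j w)%:R) (\sum_j c j * (g j w')%:R) => x y.
  by move: (\sum_j _) => z; nra.
have slope : A w' - A w < 0 by rewrite subr_lt0; exact: Adec.
have [t tP] : exists t, A w + t%:R * (A w' - A w) < 0.
  exists (Num.bound (A w / (A w - A w'))).
  have p : 0 < A w - A w' by lra.
  have := archi_boundP (divr_ge0 (A0 _ (upos n)) (ltW p)).
  rewrite ltr_pdivrMr// => h.
  by move: h; rewrite -/(A w) -/(A w'); lra.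
have := le_lt_trans (Alin t) tP; rewrite ltNge => /negP; apply; apply: A0 => i.
by rewrite addn_gt0 upos.
Qed.

(** The alternative mirrors the two clauses of [computes_mld]. A single weight serves terms of
    arbitrarily large index, so the discrepancies of computing divisors cannot be forced to grow
    along the sequence. *)
Lemma toric_logdisc_bounded_min (R : realType) N M (c : 'I_M -> R)
    (S : nat -> 'I_M -> set 'X_{1..N}) g :
  (forall j, 0 < c j) -> (forall n j, least_weight (S n j) (g n j)) ->
  exists2 w, (forall i, 0 < w i)%N & forall l, exists2 n, (l <= n)%N &
    toric_logdisc c (g n) w < 0 \/
    forall w', (forall i, 0 < w' i)%N -> 0 <= toric_logdisc c (g n) w' /\
      toric_logdisc c (g n) w <= toric_logdisc c (g n) w'.
Proof.
move=> c0 gP; have [U [UU ooU]] := free_ultrafilter.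
suff [w w0 Uw] : exists2 w, (forall i, 0 < w i)%N & U [set n |
    toric_logdisc c (g n) w < 0 \/
    forall w', (forall i, 0 < w' i)%N -> 0 <= toric_logdisc c (g n) w' /\
      toric_logdisc c (g n) w <= toric_logdisc c (g n) w'].
  exists w => // l; have /filter_ex[n [ln nP]] := ultraI UU (ultra_ge ooU l) Uw.
  by exists n.
(* If the order of some ideal at (1, ..., 1) is unbounded along [U], there is no limit ideal. But
   [A (1, ..., 1)] is already negative once that order exceeds [N / c j]. *)
have [[j nj]|bnd] := pselect (exists j, forall C,
    ~ U [set n | g n j (fun=> 1%N) <= C]%N).
  exists (fun=> 1%N) => //.
  have [//|Un] := in_ultra_setVsetC
    [set n | g n j (fun=> 1%N) <= Num.bound (N%:R / c j)]%N UU.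
    by move/nj.
  apply: filterS Un => n /= /negP; rewrite -ltnNge => gt; left.
  rewrite /toric_logdisc sum_nat_const card_ord muln1 subr_lt0.
  have := archi_boundP (divr_ge0 (ler0n R N) (ltW (c0 j))).
  rewrite ltr_pdivrMr// => h; apply: (lt_le_trans h).
  rewrite (bigD1 j)//= mulrC -[leLHS]addr0 lerD ?ler_wpM2l ?(ltW (c0 j))//.
    by rewrite ler_nat ltnW.
  by apply: sumr_ge0 => i _; rewrite mulr_ge0 ?(ltW (c0 i)).
have /boolp.choice[C CP] j : exists C, U [set n | g n j (fun=> 1%N) <= C]%N.
  by apply: contrapT => nC; apply: bnd; exists j => C UC; apply: nC; exists C.
have /boolp.choice[T /boolp.choice[h hP]] j :
    exists T h, [/\ least_weight T h, U [set n | forall w, g n j w <= h w]%N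
    & forall w, (forall i, 0 < w i)%N -> U [set n | g n j w = h w]].
  exact: (least_weight_limit UU (fun n => gP n j) (CP j)).
have Ule : U [set n | forall j, forall w, g n j w <= h j w]%N.
  by apply: ultra_forall_fin => j; have [] := hP j.
have Ueq w : (forall i, 0 < w i)%N -> U [set n | forall j, g n j w = h j w].
  by move=> w0; apply: ultra_forall_fin => j; have [_ _ /(_ w w0)] := hP j.
have Aeq n w : (forall j, g n j w = h j w) ->
    toric_logdisc c (g n) w = toric_logdisc c h w.
  by move=> e; congr (_ - _); apply: eq_bigr => j _; rewrite e.
have [[w [w0 Aw]]|nneg] := pselect (exists w, (forall i, 0 < w i)%N /\
    toric_logdisc c h w < 0).
  by exists w => //; apply: filterS (Ueq w w0) => n /= /Aeq ->; left.
have A0 w : (forall i, 0 < w i)%N -> 0 <= toric_logdisc c h w.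
  by move=> w0; rewrite leNgt; apply/negP => Aw; apply: nneg; exists w.
have hL j : least_weight (T j) (h j) by have [] := hP j.
have [w w0 wmin] := toric_logdisc_min (fun j => ltW (c0 j)) hL A0.
exists w => //; apply: filterS2 Ule (Ueq w w0) => n /= nle /Aeq ->; right.
move=> w' w'0.
have le : toric_logdisc c h w' <= toric_logdisc c (g n) w'.
  rewrite lerD2l lerN2; apply: ler_sum => j _.
  by rewrite ler_wpM2l ?(ltW (c0 j))// ler_nat.
by split; apply: le_trans le => //; [exact: A0|exact: wmin].
Qed.

(* A DCC set is well ordered, so along an ultrafilter the sequence is bounded
   above by its limit. *)
Lemma dcc_ultra_limit (R : realType) (J : set R) (U : set_system nat)
    (c : nat -> R) B :
  dcc J -> UltraFilter U -> (forall n, J (c n)) -> U [set n | `|c n| <= B] ->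
  exists x, U [set n | c n <= x] /\
    forall eps, 0 < eps -> U [set n | x - eps < c n].
Proof.
move=> dJ UU Jc UB.
pose X := [set x | U [set n | x <= c n]].
have supX : has_sup X.
  split; first by exists (- B); apply: filterS UB => n /=; rewrite ler_norml => /andP[].
  exists B => x Xx; have /filter_ex[n [/= h1 h2]] := ultraI UU UB Xx.
  exact: le_trans h2 (le_trans (ler_norm _) h1).
have below eps : 0 < eps -> U [set n | sup X - eps < c n].
  move=> e0; have [y Xy lt] := sup_adherent e0 supX.
  by apply: filterS Xy => n /=; exact: lt_le_trans.
have above y : sup X < y -> U [set n | c n < y].
  move=> lt; have [Uy|Uy] := in_ultra_setVsetC [set n | y <= c n] UU.
    by move: lt; rewrite ltNge (ub_le_sup supX.2 Uy).
  by apply: filterS Uy => n /= /negP; rewrite -ltNge.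
exists (sup X); split=> //.
(* If almost all terms exceeded [sup X], each of them would be followed by a smaller one still above
   [sup X]: a strictly decreasing sequence in [J]. *)
have [//|Ugt] := in_ultra_setVsetC [set n | c n <= sup X] UU.
have [||n nP] := @descending_seq nat (fun n => sup X < c n) (fun m n => c m < c n).
- by have /filter_ex[n /= /negP] := Ugt; rewrite -ltNge; exists n.
- move=> n lt; have /filter_ex[m [/= /negP + h2]] := ultraI UU Ugt (above _ lt).
  by rewrite -ltNge; exists m.
case: dJ; exists (c \o n) => i; split; first exact: Jc.
by have [] := nP i.
Qed.

(** The index [n] is fixed before the weight: one term with [c n <= x] and [g n <= h] dominates the
    limit function at all weights simultaneously, while the approximation by late terms [m] is
    needed at one weight at a time. *)
Lemma toric_logdisc_acc (R : realType) N M (J : set R) (c : nat -> 'I_M -> R)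
    (S : nat -> 'I_M -> set 'X_{1..N}) g :
  (forall x, J x -> 0 < x) -> dcc J -> (forall n j, J (c n j)) ->
  (forall n j, c n j <= N.+1%:R) ->
  (forall n j, least_weight (S n j) (g n j)) ->
  (forall n w, (forall i, 0 < w i)%N -> 0 <= toric_logdisc (c n) (g n) w) ->
  exists n, forall w, (forall i, 0 < w i)%N -> forall eps l, 0 < eps ->
    exists2 m, (l <= m)%N &
    toric_logdisc (c m) (g m) w <= toric_logdisc (c n) (g n) w + eps.
Proof.
move=> J0 dJ Jc cB gP A0; have [U [UU ooU]] := free_ultrafilter.
have c0 n j : 0 < c n j by exact/J0/Jc.
have Ubnd j : U [set n | `|c n j| <= N.+1%:R].
  by apply: filterS filterT => n _ /=; rewrite gtr0_norm.
have /boolp.choice[x xP] j := dcc_ultra_limit dJ UU (Jc ^~ j) (Ubnd j).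
have Ux : U [set n | forall j, c n j <= x j].
  by apply: ultra_forall_fin => j; have [] := xP j.
have Ueps eps : 0 < eps -> U [set n | forall j, x j - eps < c n j].
  by move=> e0; apply: ultra_forall_fin => j; have [_ /(_ _ e0)] := xP j.
have x0 j : 0 < x j.
  by have /filter_ex[n /(_ j)] := Ux; exact: lt_le_trans (c0 n j).
have /boolp.choice[T /boolp.choice[h hP]] j :
    exists T h, [/\ least_weight T h, U [set n | forall w, g n j w <= h w]%N
    & forall w, (forall i, 0 < w i)%N -> U [set n | g n j w = h w]].
  (* Almost all exponents are at least half of their positive limit, so nonnegativity of [A] at (1,
     ..., 1) bounds the orders by [N / (x j / 2)]. *)
  apply: (least_weight_limit (C := Num.bound (N%:R / (x j / 2))) UU
    (fun n => gP n j)).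
  have x20 : 0 < x j / 2 by rewrite divr_gt0.
  apply: filterS (Ueps _ x20) => n /= xc.
  have := A0 n (fun=> 1%N) (fun=> isT).
  rewrite /toric_logdisc sum_nat_const card_ord muln1 subr_ge0 => le.
  have : c n j * (g n j (fun=> 1%N))%:R <= N%:R.
    apply: le_trans le; rewrite (bigD1 j)//= lerDl.
    by apply: sumr_ge0 => i _; rewrite mulr_ge0 ?(ltW (c0 n i)).
  have {}xc : x j / 2 <= c n j by move: (xc j); lra.
  move=> h; have {}h : x j / 2 * (g n j (fun=> 1%N))%:R <= N%:R.
    by apply: le_trans h; rewrite ler_wpM2r.
  move: h; rewrite mulrC -ler_pdivlMr// => h.
  rewrite -(ler_nat R); apply: (le_trans h); apply: ltW.
  by apply: archi_boundP; rewrite divr_ge0// ltW.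
have Ule : U [set n | forall j, forall w, g n j w <= h j w]%N.
  by apply: ultra_forall_fin => j; have [] := hP j.
have Ueq w : (forall i, 0 < w i)%N -> U [set n | forall j, g n j w = h j w].
  by move=> w0; apply: ultra_forall_fin => j; have [_ _ /(_ w w0)] := hP j.
have /filter_ex[n [/= nx nh]] := ultraI UU Ux Ule.
exists n => w w0 eps l e0.
(* The error in the [j]-th exponent is multiplied by [h j w], so errors below [eps / K] add up to at
   most [eps]. The summand 1 keeps [K] positive. *)
pose K : R := (\sum_j h j w)%:R + 1.
have K0 : 0 < K by rewrite ltr_wpDl.
have eK : 0 < eps / K by rewrite divr_gt0.
have /filter_ex[m [/= [lm me] mh]] :=
  ultraI UU (ultraI UU (ultra_ge ooU l) (Ueps _ eK)) (Ueq w w0).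
exists m => //; rewrite /toric_logdisc -addrA lerD2l lerNl opprD opprK.
rewrite lerBlDr; under [X in _ <= X + _]eq_bigr do rewrite mh.
apply: (@le_trans _ _ (\sum_j x j * (h j w)%:R)).
  apply: ler_sum => j _; apply: ler_pM => //; first exact/ltW.
  by rewrite ler_nat.
apply: (@le_trans _ _ (\sum_j (c m j * (h j w)%:R + eps / K * (h j w)%:R))).
  apply: ler_sum => j _; rewrite -mulrDl ler_wpM2r//.
  by move: (me j); lra.
rewrite big_split lerD2l -mulr_sumr -natr_sum mulrAC ler_pdivrMr// ler_pM2l//.
by rewrite lerDl.
Qed.

(** * Discrepancies and logarithmic forms *)

(** In the multilinear expansion, a term with two rows replaced by multiples of [r] vanishes. The
    matrix [T m A], updated in its first [m] rows only, makes this an induction on [m]. *)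
Lemma det_rank_one_update (R : comNzRingType) n (A : 'M[R]_n)
    (c r : 'I_n -> R) :
  \det (\matrix_(i, j) (A i j + c i * r j)) =
  \det A + \sum_i c i * \det (\matrix_(l, j) (if l == i then r j else A l j)).
Proof.
pose T (m : nat) (A : 'M[R]_n) : 'M[R]_n :=
  \matrix_(i, j) (if (i < m)%N then A i j + c i * r j else A i j).
pose Q (A : 'M[R]_n) i : 'M[R]_n :=
  \matrix_(l, j) (if l == i then r j else A l j).
have H m : (m <= n)%N -> forall A, \det (T m A) =
    \det A + \sum_(i < n | (i < m)%N) c i * \det (Q A i).
  elim: m => [|m IH] mn {}A.
    rewrite big_pred0 ?addr0//; congr (\det _); apply/matrixP => i j.
    by rewrite mxE.
  pose o := Ordinal mn.
  rewrite (@determinant_multilinear _ _ (T m.+1 A) (T m A) (T m (Q A o)) o 1 (c o)).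
  - rewrite mul1r !IH ?(ltnW mn)// [X in _ * (_ + X)]big1 => [|i im].
      rewrite addr0 [in RHS](bigD1 o)//= [X in _ = _ + X]addrC addrA.
      congr (_ + _ + _); apply: eq_bigl => i.
      rewrite ltnS [in RHS]leq_eqVlt -(inj_eq val_inj) /=.
      by case: (ltngtP i m).
    rewrite (@determinant_alternate _ _ _ i o) ?mulr0//.
      by apply/eqP => e; move: im; rewrite e ltnn.
    by move=> j; rewrite !mxE !eqxx; case: ifP.
  - by apply/rowP => j; rewrite !mxE /= ltnSn ltnn eqxx mul1r.
  - apply/matrixP => i j; have := neq_lift o i; rewrite eq_sym => ne.
    rewrite !mxE ltnS [in RHS]leq_eqVlt.
    by have := ne; rewrite -(inj_eq val_inj) => /negPf /= ->.
  - apply/matrixP => i j; have := neq_lift o i; rewrite eq_sym => ne.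
    rewrite !mxE (negPf ne) ltnS [in RHS]leq_eqVlt.
    by have := ne; rewrite -(inj_eq val_inj) => /negPf /= ->.
have := H n (leqnn n) A.
have -> : T n A = \matrix_(i, j) (A i j + c i * r j).
  by apply/matrixP => i j; rewrite !mxE ltn_ord.
by move=> ->; congr (_ + _); apply: eq_bigl => i; rewrite ltn_ord.
Qed.

Section Valuation.
Variables (K : fieldType) (v : K -> int).
Hypothesis vM : forall x y, x != 0 -> y != 0 -> v (x * y) = v x + v y.
Hypothesis vD : forall x y, x != 0 -> y != 0 -> x + y != 0 ->
  Num.min (v x) (v y) <= v (x + y).

(** The value [v 0] is arbitrary, so zero is put into every level by fiat; the levels are then
    closed under addition. *)
Definition vge (n : int) (x : K) := (x == 0) || (n <= v x).

Lemma val1 : v 1 = 0.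
Proof.
have := vM (oner_neq0 K) (oner_neq0 K); rewrite mulr1 => h.
by apply: (addrI (v 1)); rewrite -h addr0.
Qed.

Lemma valV x : x != 0 -> v x^-1 = - v x.
Proof.
move=> x0; have := vM x0 (invr_neq0 x0).
by rewrite mulfV// val1; lia.
Qed.

Lemma valX x n : x != 0 -> v (x ^+ n) = v x *+ n.
Proof.
move=> x0; elim: n => [|n IH]; first by rewrite expr0 val1.
by rewrite exprS vM ?expf_neq0// IH mulrS.
Qed.

Lemma valN x : x != 0 -> v (- x) = v x.
Proof.
move=> x0; have n1 : -1 != 0 :> K by rewrite oppr_eq0 oner_neq0.
have := vM n1 n1; rewrite mulrNN mulr1 val1 => h.
by rewrite -mulN1r vM//; lia.
Qed.

Lemma vge0 n : vge n 0. Proof. by rewrite /vge eqxx. Qed.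

Lemma vgeE n x : x != 0 -> vge n x = (n <= v x).
Proof. by rewrite /vge => /negPf ->. Qed.

Lemma vgeW m n x : n <= m -> vge m x -> vge n x.
Proof. by rewrite /vge => nm /orP[->//|/(le_trans nm) ->]; rewrite orbT. Qed.

Lemma vge1 : vge 0 1. Proof. by rewrite /vge val1 lexx orbT. Qed.

Lemma vgeN n x : vge n x -> vge n (- x).
Proof.
have [->|x0] := eqVneq x 0; first by rewrite oppr0.
by rewrite !vgeE ?oppr_eq0// valN.
Qed.

Lemma vgeD n x y : vge n x -> vge n y -> vge n (x + y).
Proof.
have [->|x0] := eqVneq x 0; first by rewrite add0r.
have [->|y0] := eqVneq y 0; first by rewrite addr0.
have [->|xy0] := eqVneq (x + y) 0; first by move=> _ _; exact: vge0.
by rewrite !vgeE// => nx ny; apply: le_trans (vD x0 y0 xy0); rewrite le_min nx.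
Qed.

Lemma vgeM m n x y : vge m x -> vge n y -> vge (m + n) (x * y).
Proof.
have [->|x0] := eqVneq x 0; first by rewrite mul0r => _ _; exact: vge0.
have [->|y0] := eqVneq y 0; first by rewrite mulr0 => _ _; exact: vge0.
by rewrite !vgeE ?mulf_neq0// vM// => *; rewrite lerD.
Qed.

Lemma vge_exp n m x : vge n x -> vge (n *+ m) (x ^+ m).
Proof.
move=> nx; elim: m => [|m IH]; first exact: vge1.
by rewrite exprS mulrS vgeM.
Qed.

Lemma vge_sum n (I : Type) (r : seq I) (P : pred I) (F : I -> K) :
  (forall i, P i -> vge n (F i)) -> vge n (\sum_(i <- r | P i) F i).
Proof.
move=> nF; apply: (big_rec (vge n)) => [|i x Pi nx]; first exact: vge0.
by apply: vgeD => //; exact: nF.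
Qed.

Lemma vge_prod (I : Type) (r : seq I) (P : pred I) n (F : I -> K) :
  (forall i, vge (n i) (F i)) ->
  vge (\sum_(i <- r | P i) n i) (\prod_(i <- r | P i) F i).
Proof.
move=> nF; apply: (big_rec2 (fun m x => vge m x)) => [|i m x _]; first exact: vge1.
exact: vgeM.
Qed.

Lemma vge_det N n (M : 'M[K]_N) :
  (forall i j, vge (n i) (M i j)) -> vge (\sum_i n i) (\det M).
Proof.
move=> nM; apply: vge_sum => s _; rewrite -signr_odd.
have : vge (\sum_i n i) (\prod_i M i (s i)) by exact: vge_prod.
by case: (odd _); rewrite ?expr0 ?expr1 ?mul1r// mulN1r; exact: vgeN.
Qed.

(* Writing [x_i = u_i t^(w_i)], the Jacobian matrix of [x] is a rank one update
   of [diag (t^(w_i)) (D_j u_i)], so [dx_1 /\ ... /\ dx_N] is [x_1 ... x_N] times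
   a form with at most a simple pole. *)
Lemma sum_val_le_jacobian (N : nat) (D : 'I_N -> K -> K) (x : 'I_N -> K) (t : K)
    (d : int) :
  (forall j y z, D j (y * z) = D j y * z + y * D j z) ->
  (forall j y n, D j (y ^+ n) = n%:R * y ^+ n.-1 * D j y) ->
  (forall n : nat, vge 0 n%:R) ->
  (forall i, x i != 0) -> (forall i, 0 < v (x i)) ->
  \det (\matrix_(i, j) D j (x i)) = 1 -> t != 0 -> v t = 1 ->
  (forall f : 'I_N -> K, (forall i, vge 0 (f i)) ->
     vge (- d) (\det (\matrix_(i, j) D j (f i)))) ->
  \sum_i v (x i) <= d + 1.
Proof.
move=> DM DX vnat x0 vx0 detx t0 vt jge.
pose w i := `|v (x i)|%N.
have wE i : v (x i) = (w i)%:Z by rewrite /w; have := vx0 i; lia.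
have w0 i : (0 < w i)%N by have := vx0 i; rewrite wE.
pose u i := x i / t ^+ w i.
have xu i : x i = u i * t ^+ w i by rewrite /u divfK// expf_neq0.
have vtn n : v (t ^+ n) = n%:Z by rewrite valX// vt; lia.
have Ot : vge 0 t by rewrite vgeE// vt.
have Ou i : vge 0 (u i).
  rewrite vgeE ?mulf_neq0 ?invr_eq0 ?expf_neq0// /u vM ?invr_eq0 ?expf_neq0//.
  by rewrite valV ?expf_neq0// vtn wE subrr.
(* The tuple [u] with [u_i] replaced by [t]. Both [u] and all [f i] are integral, so the hypothesis
   on Jacobians applies to each of them. *)
pose f i l := if l == i then t else u l.
have vgt n : vge n%:Z (t ^+ n) by rewrite vgeE ?expf_neq0// vtn.
have vgp (P : pred 'I_N) :
    vge (\sum_(l | P l) (w l)%:Z) (\prod_(l | P l) t ^+ w l).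
  exact: vge_prod.
pose A : 'M[K]_N := \matrix_(i, j) (t ^+ w i * D j (u i)).
have e : 1 = (\prod_i t ^+ w i) * \det (\matrix_(i, j) D j (u i)) + \sum_i
    ((w i)%:R * u i * t ^+ (w i).-1) *
    ((\prod_(l | l != i) t ^+ w l) * \det (\matrix_(l, j) D j (f i l))).
  rewrite -[LHS]detx.
  transitivity (\det (\matrix_(i, j)
      (A i j + ((w i)%:R * u i * t ^+ (w i).-1) * D j t))).
    congr (\det _); apply/matrixP => i j; rewrite !mxE [in LHS]xu DM DX.
    rewrite [D j (u i) * _]mulrC; congr (_ + _).
    by move: (u i) => z; rewrite -!mulrA mulrCA.
  rewrite det_rank_one_update; congr (_ + _).
    have -> : A = diag_mx (\row_i t ^+ w i) *m (\matrix_(i, j) D j (u i)).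
      by apply/matrixP => i j; rewrite mul_diag_mx !mxE.
    rewrite det_mulmx det_diag; congr (_ * _).
    by apply: eq_bigr => i _; rewrite mxE.
  apply: eq_bigr => i _; congr (_ * _).
  have -> : \matrix_(l, j) (if l == i then D j t else A l j) =
      diag_mx (\row_l (if l == i then 1 else t ^+ w l)) *m
      (\matrix_(l, j) D j (f i l)).
    apply/matrixP => l j; rewrite mul_diag_mx !mxE /f.
    by case: eqP; rewrite ?mul1r.
  rewrite det_mulmx det_diag; congr (_ * _).
  rewrite (bigD1 i)//= mxE eqxx mul1r.
  by apply: eq_bigr => l li; rewrite mxE (negPf li).
(* The [i]-th summand of [e] loses one power of [t] to the factor [t ^+ (w i).-1]. Since 1 has order
   0, the bound itself is at most 0. *)
have : vge (\sum_i v (x i) - 1 - d) 1.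
  rewrite e; apply: vgeD.
    apply: vgeW (vgeM (vgp _) (jge _ Ou)).
    rewrite (eq_bigr _ (fun i _ => wE i)).
    by move: (\sum_i _) => z; lia.
  apply: vge_sum => i _.
  have h1 : vge (w i).-1%:Z ((w i)%:R * u i * t ^+ (w i).-1).
    rewrite -[X in vge X _]add0r; apply: vgeM => //.
    by rewrite -[0]addr0; apply: vgeM.
  have Of l : vge 0 (f i l) by rewrite /f; case: eqP.
  apply: vgeW (vgeM h1 (vgeM (vgp _) (jge _ Of))).
  rewrite (bigD1 i)//= wE (eq_bigr _ (fun i _ => wE i)).
  by move: (w0 i) (\sum_(_ | _) _) => h z; lia.
by rewrite vgeE ?oner_neq0// val1; lia.
Qed.

End Valuation.

(** * Derivations of the function field and orders of Jacobians *)

Lemma quotient_rule_mul (F : fieldType) (a b c d a' b' c' d' : F) :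
  b != 0 -> d != 0 ->
  ((a' * c + a * c') * (b * d) - a * c * (b' * d + b * d')) / (b * d) ^+ 2 =
  (a' * b - a * b') / b ^+ 2 * (c / d) + a / b * ((c' * d - c * d') / d ^+ 2).
Proof. by move=> b0 d0; field; rewrite b0 d0. Qed.

Lemma quotient_rule_add (F : fieldType) (a b c d a' b' c' d' : F) :
  b != 0 -> d != 0 ->
  ((a' * d + a * d' + (c' * b + c * b')) * (b * d) -
    (a * d + c * b) * (b' * d + b * d')) / (b * d) ^+ 2 =
  (a' * b - a * b') / b ^+ 2 + (c' * d - c * d') / d ^+ 2.
Proof. by move=> b0 d0; field; rewrite b0 d0. Qed.

Section Derivations.
Variables (k : fieldType) (N : nat).
Local Notation K := (funfield k N).
Implicit Types (i : 'I_N) (x y : K) (a b : {mpoly k[N]}).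

Lemma frac_ex x : exists a b, b != 0 /\ x = a%:F / b%:F.
Proof.
exists \n_(repr x), \d_(repr x); split; first exact: denom_ratioP.
exact: frac_reprE.
Qed.

Lemma fderiv_div i a b : b != 0 ->
  fderiv i (a%:F / b%:F) =
  ((a^`M(i))%:F * b%:F - a%:F * (b^`M(i))%:F) / b%:F ^+ 2.
Proof. by move=> b0; rewrite fderivE// tofracXn tofracB !tofracM. Qed.

Lemma fderiv_tofrac i a : fderiv i a%:F = (a^`M(i))%:F.
Proof.
rewrite -[in LHS](divr1 a%:F) -[X in _ / X]tofrac1 fderiv_div ?oner_neq0//.
rewrite tofrac1 -[1 in X in _ - X]mpolyC1 mderivC tofrac0.
by rewrite mulr0 subr0 mulr1 expr1n divr1.
Qed.

Lemma fderivC i (c : k) : fderiv i (c%:MP)%:F = 0.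
Proof. by rewrite fderiv_tofrac mderivC tofrac0. Qed.

Lemma fderivM i x y : fderiv i (x * y) = fderiv i x * y + x * fderiv i y.
Proof.
have [a [b [b0 ->]]] := frac_ex x; have [c [d [d0 ->]]] := frac_ex y.
rewrite mulf_div -!tofracM !fderiv_div ?mulf_neq0// !mderivM.
rewrite [in LHS]tofracD [in LHS]tofracD !tofracM.
by apply: quotient_rule_mul; rewrite tofrac_eq0.
Qed.

Lemma fderivD i x y : fderiv i (x + y) = fderiv i x + fderiv i y.
Proof.
have [a [b [b0 ->]]] := frac_ex x; have [c [d [d0 ->]]] := frac_ex y.
rewrite addf_div ?tofrac_eq0// -!tofracM -tofracD !fderiv_div ?mulf_neq0//.
rewrite mderivD !mderivM.
rewrite [in LHS]tofracD [in LHS]tofracD [in LHS]tofracD.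
rewrite [in LHS]tofracD [in LHS]tofracD !tofracM.
by apply: quotient_rule_add; rewrite tofrac_eq0.
Qed.

Lemma fderiv1 i : fderiv i (1 : K) = 0.
Proof. by rewrite -tofrac1 -mpolyC1 fderivC. Qed.

Lemma fderivXn i x n : fderiv i (x ^+ n) = n%:R * x ^+ n.-1 * fderiv i x.
Proof.
elim: n => [|[|n] IH]; first by rewrite expr0 fderiv1 !mul0r.
  by rewrite expr1 /= expr0 mulr1 mul1r.
rewrite exprS fderivM IH /=; set d := fderiv i x.
have -> : x * (n.+1%:R * x ^+ n * d) = n.+1%:R * x ^+ n.+1 * d.
  by rewrite exprS !mulrA [x * _]mulrC.
by rewrite -[n.+2%:R]natr1 !mulrDl mul1r addrC [d * _]mulrC.
Qed.

Lemma fderivV i x : x != 0 -> fderiv i x^-1 = - fderiv i x / x ^+ 2.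
Proof.
move=> x0; have := fderivM i x x^-1; rewrite mulfV// fderiv1 => e.
apply: (mulfI x0); apply: (addrI (fderiv i x * x^-1)); rewrite -e.
by rewrite mulNr mulrN expr2 invfM mulrCA [x * _]mulrA mulfV// mul1r subrr.
Qed.

Lemma fderivX i j : fderiv i ('X_j)%:F = (i == j)%:R :> K.
Proof.
rewrite fderiv_tofrac mderivX mnm1E eq_sym; case: eqVneq => [->|_].
  have -> : (U_(j) - U_(j))%MM = 0%MM :> 'X_{1..N}.
    by apply/mnmP => l; rewrite mnmBE mnm0E subnn.
  by rewrite scale1r mpolyX0 tofrac1.
by rewrite scale0r tofrac0.
Qed.

Lemma jacobianX : jacobian (fun i => ('X_i)%:F) = 1 :> K.
Proof.
rewrite -[RHS](det1 _ N); congr (\det _); apply/matrixP => i j.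
by rewrite !mxE fderivX eq_sym.
Qed.

Lemma gen_subalgE n (y : 'I_n -> K) :
  gen_subalg y = range (mmap (@FracField.tofrac _ \o @mpolyC N k) y).
Proof. by []. Qed.

Lemma gen_subalgC n (y : 'I_n -> K) (c : k) : gen_subalg y (c%:MP)%:F.
Proof. by rewrite gen_subalgE; exists c%:MP => //; rewrite mmapC. Qed.

Lemma gen_subalg_gen n (y : 'I_n -> K) l : gen_subalg y (y l).
Proof. by rewrite gen_subalgE; exists 'X_l => //; rewrite mmapX mmap1U. Qed.

Lemma gen_subalgD n (y : 'I_n -> K) x z :
  gen_subalg y x -> gen_subalg y z -> gen_subalg y (x + z).
Proof.
by rewrite gen_subalgE => -[p _ <-] [q _ <-]; exists (p + q) => //; rewrite mmapD.
Qed.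

Lemma gen_subalgM n (y : 'I_n -> K) x z :
  gen_subalg y x -> gen_subalg y z -> gen_subalg y (x * z).
Proof.
rewrite gen_subalgE => -[p _ <-] [q _ <-]; exists (p * q) => //.
by rewrite rmorphM.
Qed.

Lemma gen_subalg1 n (y : 'I_n -> K) : gen_subalg y 1.
Proof. by rewrite -tofrac1 -mpolyC1; exact: gen_subalgC. Qed.

Lemma gen_subalg0 n (y : 'I_n -> K) : gen_subalg y 0.
Proof. by rewrite -tofrac0 -(mpolyC0 N); exact: gen_subalgC. Qed.

Lemma gen_subalgX n (y : 'I_n -> K) x m :
  gen_subalg y x -> gen_subalg y (x ^+ m).
Proof.
move=> yx; elim: m => [|m IH]; first by rewrite expr0; exact: gen_subalg1.
by rewrite exprS; exact: gen_subalgM.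
Qed.

Lemma gen_subalg_ind n (y : 'I_n -> K) (Q : set K) :
  (forall c : k, Q (c%:MP)%:F) -> (forall l, Q (y l)) ->
  (forall x z, Q x -> Q z -> Q (x + z)) -> (forall x z, Q x -> Q z -> Q (x * z)) ->
  gen_subalg y `<=` Q.
Proof.
move=> QC Qy QD QM _ [q _ <-]; rewrite /mmap.
have Q0 : Q 0 by rewrite -tofrac0 -(mpolyC0 N); exact: QC.
have Q1 : Q 1 by rewrite -tofrac1 -mpolyC1; exact: QC.
apply: (big_ind Q) => // m _; apply: (QM) => //; rewrite /mmap1.
apply: (big_ind Q) => [//|x z|i _]; first exact: QM.
by elim: (m i) => [//|j IH]; rewrite exprS; exact: QM.
Qed.

End Derivations.

Section PrimeDivisors.
Variables (k : fieldType) (N : nat) (E : prime_divisor k N).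
Local Notation K := (funfield k N).
Local Notation B := (gen_subalg (pd_gen (p := E))).
Local Notation v := (pd_ord E).

Lemma pd_ordM (x y : K) : x != 0 -> y != 0 -> v (x * y) = v x + v y.
Proof. by have [+ _ _ _] := pd_ordP E; apply. Qed.

Lemma pd_ordD (x y : K) : x != 0 -> y != 0 -> x + y != 0 ->
  Num.min (v x) (v y) <= v (x + y).
Proof. by have [_ + _ _] := pd_ordP E; apply. Qed.

Lemma local_ringE (x : K) : local_ring E x <-> vge v 0 x.
Proof.
have [_ _ _ vO] := pd_ordP E; have [_ [P0 nP1] _ _ _] := pd_primeP E.
have [->|x0] := eqVneq x 0; last by rewrite vgeE// vO.
split=> _; first exact: vge0.
exists 0, 1; split=> //; [exact: gen_subalg0|exact: gen_subalg1|].
by rewrite mul0r.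
Qed.

Lemma subalg_vge (x : K) : B x -> vge v 0 x.
Proof.
move=> Bx; apply/local_ringE; have [_ [_ nP1] _ _ _] := pd_primeP E.
by exists x, 1; split=> //; [exact: gen_subalg1|rewrite divr1].
Qed.

Lemma tofracX_neq0 i : ('X_i)%:F != 0 :> K.
Proof. by rewrite tofrac_eq0 -mleadc_eq0 mleadXm mcoeffX eqxx oner_neq0. Qed.

Lemma pd_ordX_ge0 i : 0 <= v ('X_i)%:F.
Proof.
rewrite -vgeE ?tofracX_neq0//; apply: subalg_vge; exact: pd_dominates.
Qed.

(** If the order of [x] were at most 0, then [x^-1 = a / b] with [b] outside the prime, yet
    [b = a x] lies in it. *)
Lemma pd_ord_gt0 (x : K) : x != 0 -> pd_prime E x -> 0 < v x.
Proof.
move=> x0 Px; have [_ _ _ vO] := pd_ordP E; have [_ _ _ PM _] := pd_primeP E.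
rewrite -oppr_lt0 -(valV pd_ordM)// ltNge; apply/negP.
move=> /(vO _ (invr_neq0 x0)) [a [b [Ba Bb nPb xab]]].
have b0 : b != 0.
  by apply: contra_not_neq nPb => ->; have [_ []] := pd_primeP E.
apply: nPb; have -> : b = a * x.
  apply: (mulfI (invr_neq0 x0)).
  by rewrite mulrCA mulVf// mulr1 {1}xab divfK.
exact: PM.
Qed.

(** Finite generation of the chart bounds the poles: by the Leibniz rule only the derivatives of the
    generators contribute, and inverting an element of order 0 adds no pole. *)
Lemma fderiv_vge : exists C : nat, forall (x : K) j,
  vge v 0 x -> vge v (- C%:Z) (fderiv j x).
Proof.
pose C := (\sum_l \sum_j `|v (fderiv j (pd_gen (p := E) l))|)%N.
exists C.
have BC (x : K) j : B x -> vge v (- C%:Z) (fderiv j x).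
  move=> Bx.
  suff : B `<=` [set x | vge v 0 x /\ vge v (- C%:Z) (fderiv j x)].
    by move=> /(_ _ Bx)[].
  apply: gen_subalg_ind.
  - move=> c /=; rewrite fderivC; split; last exact: vge0.
    exact/subalg_vge/gen_subalgC.
  - move=> l /=; split; first exact/subalg_vge/gen_subalg_gen.
    have [->|d0] := eqVneq (fderiv j (pd_gen l)) 0; first exact: vge0.
    rewrite vgeE//.
    have : (`|v (fderiv j (pd_gen (p := E) l))| <= C)%N.
      rewrite /C (bigD1 l)//= (bigD1 j)//=.
      by rewrite -addnA leq_addr.
    lia.
  - move=> x1 z [x0 xC] [z0 zC] /=; rewrite fderivD.
    by split; apply: (vgeD pd_ordD).
  - move=> x1 z [x0 xC] [z0 zC] /=; rewrite fderivM; split.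
      by rewrite -[0]addr0; apply: (vgeM pd_ordM).
    apply: (vgeD pd_ordD).
      by rewrite -[- _]addr0; apply: (vgeM pd_ordM).
    by rewrite -[- _]add0r; apply: (vgeM pd_ordM).
move=> x j /local_ringE [a [b [Ba Bb nPb ->]]].
have b0 : b != 0.
  by apply: contra_not_neq nPb => ->; have [_ []] := pd_primeP E.
have vb : v b = 0.
  have : 0 <= v b by rewrite -vgeE//; exact: subalg_vge.
  have : 0 <= v b^-1.
    rewrite -vgeE ?invr_eq0//; apply/local_ringE; exists 1, b; split=> //.
      exact: gen_subalg1.
    by rewrite mul1r.
  by rewrite (valV pd_ordM)//; lia.
have vbi n : vge v 0 (b^-1 ^+ n).
  rewrite vgeE ?expf_neq0 ?invr_eq0// (valX pd_ordM) ?invr_eq0//.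
  by rewrite (valV pd_ordM)// vb oppr0 mul0rn.
rewrite fderivM fderivV//; apply: (vgeD pd_ordD).
  rewrite -[- _]addr0; apply: (vgeM pd_ordM); first exact: BC.
  by rewrite -[b^-1]expr1.
rewrite -[- _]add0r; apply: (vgeM pd_ordM); first exact: subalg_vge.
rewrite -[- _]addr0; apply: (vgeM pd_ordM).
  by apply: (vgeN pd_ordM); exact: BC.
by rewrite -exprVn; exact: vbi.
Qed.

Lemma is_discrepancy_inj m n : is_discrepancy E m -> is_discrepancy E n -> m = n.
Proof.
move=> [m1 [f [f1 f2 f3]]] [n1 [g [g1 g2 g3]]].
by have := m1 _ g1 g2; have := n1 _ f1 f2; rewrite f3 g3; lia.
Qed.

(** The orders of nonzero Jacobians are integers bounded below by [- C N], and the coordinates, with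
    Jacobian 1, provide one, so a least order exists. The shift by [C * N] places the search in
    [nat]. *)
Lemma discrepancyP : is_discrepancy E (discrepancy E).
Proof.
suff ex : exists n, is_discrepancy E n.
  have := xgetPex 0 (P := [set n | is_discrepancy E n]).
  by rewrite /discrepancy; apply.
have [C CP] := fderiv_vge.
have bnd f : (forall i, local_ring E (f i)) -> jacobian f != 0 ->
    - (C * N)%N%:Z <= v (jacobian f).
  move=> Of j0; rewrite -vgeE//.
  apply: vgeW; last first.
    apply: (vge_det pd_ordM pd_ordD (n := fun=> - C%:Z)) => i j; rewrite mxE.
    by apply: CP; apply/local_ringE.
  by rewrite sumr_const card_ord PoszM; lia.
have ex : exists n : nat, `[< exists f, [/\ forall i, local_ring E (f i),
    jacobian f != 0 & v (jacobian f) = n%:Z - (C * N)%N%:Z] >].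
  exists (C * N)%N; apply/asboolP; exists (fun i => ('X_i)%:F).
  rewrite jacobianX oner_neq0 (val1 pd_ordM) subrr; split=> // i.
  by apply/local_ringE; rewrite vgeE ?tofracX_neq0 ?pd_ordX_ge0.
have [n /asboolP[f [Of j0 vf]] nmin] := ex_minnP ex.
exists ((C * N)%N%:Z - n%:Z); split; last first.
  by exists f; split=> //; rewrite vf; lia.
move=> g Og g0; have gb := bnd g Og g0.
suff : (n <= absz (v (jacobian g) + (C * N)%N%:Z)%R)%N by lia.
by apply: nmin; apply/asboolP; exists g; split=> //; lia.
Qed.

Lemma sum_ord_le_discrepancy : (forall i, 0 < v ('X_i)%:F) ->
  \sum_i v ('X_i)%:F <= discrepancy E + 1.
Proof.
move=> vX0; have [_ _ [t t0 vt] _] := pd_ordP E; have [kE _] := discrepancyP.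
apply: (sum_val_le_jacobian pd_ordM pd_ordD (D := fderiv) (x := fun i => ('X_i)%:F)
  (@fderivM _ _) (@fderivXn _ _) _ _ vX0 (jacobianX k N) t0 vt).
- move=> n; rewrite -tofrac1 -mpolyC1 -rmorphMn -mpolyCMn.
  exact/subalg_vge/gen_subalgC.
- exact: tofracX_neq0.
- move=> f Of; have [j0|j0] := eqVneq (jacobian f) 0.
    by rewrite -/(jacobian f) j0; exact: vge0.
  by rewrite vgeE//; apply: kE => // i; exact/local_ringE.
Qed.

End PrimeDivisors.

(** * Monomial valuations *)

Lemma mul_expr_div (F : fieldType) (x a b : F) n : b != 0 ->
  x * (a / b) ^+ n * b ^+ n = x * a ^+ n.
Proof. by move=> b0; rewrite expr_div_n -mulrA divfK// expf_neq0. Qed.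

Lemma expr_mul_div (F : fieldType) (a b : F) n d : b != 0 -> (n <= d)%N ->
  b ^+ d * (a / b) ^+ n = b ^+ (d - n) * a ^+ n.
Proof.
move=> b0 nd; rewrite expr_div_n -{1}(subnK nd) exprD -mulrA.
by rewrite [b ^+ n * _]mulrC divfK// expf_neq0.
Qed.

Section PolynomialRingNormal.
Variables (k : fieldType) (N : nat).
Local Notation K := (funfield k N).
Implicit Types (a b c : {mpoly k[N]}).

(* If [c (a / b)^n] is a polynomial for all [n], then the leading monomial of [b]
   divides that of [a]; subtract a monomial from [a / b] and induct. *)
Lemma almost_integral_mpoly a b c : c != 0 -> b != 0 ->
  (forall n, exists q, c * a ^+ n = q * b ^+ n) -> exists q, a = q * b.
Proof.
move=> c0 b0.
move mE : (mlead a) => m; elim/(well_founded_ind (@ltom_wf N)): m a mE => m IH a mE aint.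
have [->|a0] := eqVneq a 0; first by exists 0; rewrite mul0r.
have lead_le : (mlead b <= mlead a)%MM.
  (* The power is one more than the exponent of [X_i] in the leading monomial of [c]. If
     [a_i < b_i], comparing exponents in [c a^n = q b^n] gives [n <= c_i], a contradiction. *)
  apply/mnm_lepP => i; have [q qE] := aint (mlead c i).+1.
  have q0 : q != 0.
    apply: contra_neq (mulf_neq0 c0 (expf_neq0 (mlead c i).+1 a0)) => q0.
    by rewrite qE q0 mul0r.
  have leadMX (p r : {mpoly k[N]}) n : p != 0 -> r != 0 ->
      mlead (p * r ^+ n) = (mlead p + mlead r *+ n)%MM :> 'X_{1..N}.
    by move=> p0 r0; rewrite (mleadM p0 (expf_neq0 n r0)) (mleadX n r0).
  have := congr1 (fun p : {mpoly k[N]} => mlead p) qE.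
  rewrite (leadMX _ _ _ c0 a0) (leadMX _ _ _ q0 b0).
  move=> /(congr1 (fun m : 'X_{1..N} => m i)); rewrite !mnmDE !mulmnE.
  move: (mlead c i) (mlead a i) (mlead b i) (mlead q i) => x y z t.
  nia.
pose t := (mleadc a / mleadc b) *: 'X_[mlead a - mlead b] : {mpoly k[N]}.
have t0 : t != 0.
  rewrite mscalerI negb_or mulf_neq0 ?invr_eq0 ?mleadc_eq0//=.
  by rewrite -mleadc_eq0 mleadXm mcoeffX eqxx oner_neq0.
have tb_lead : mlead (t * b) = mlead a.
  rewrite mleadM// mleadZ ?mulf_neq0 ?invr_eq0 ?mleadc_eq0// mleadXm.
  exact: submK.
have tb_coef : (t * b)@_(mlead a) = mleadc a.
  have cb : ('X_[mlead a - mlead b] * b)@_(mlead a - mlead b + mlead b) = mleadc b.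
    by rewrite mulrC mcoeffMX.
  rewrite submK// in cb.
  by rewrite -scalerAl mcoeffZ cb divfK// mleadc_eq0.
have aint' n : exists q, c * (a - t * b) ^+ n = q * b ^+ n.
  have /boolp.choice[q qE] := aint.
  exists (\sum_(i < n.+1) ((-1) ^+ i * q (n - i)%N * t ^+ i) *+ 'C(n, i)).
  rewrite exprBn big_distrr big_distrl /=; apply: eq_bigr => i _.
  rewrite mulrnAr mulrnAl; congr (_ *+ _).
  have -> : b ^+ n = b ^+ (n - i) * b ^+ i by rewrite -exprD subnK// -ltnS.
  rewrite exprMn.
  transitivity ((-1) ^+ i * (c * a ^+ (n - i)) * (t ^+ i * b ^+ i)); first by ring.
  by rewrite qE; ring.
have [e|a'0] := eqVneq (a - t * b) 0.
  by exists t; apply/eqP; rewrite -subr_eq0 e.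
have lt : (mlead (a - t * b) < m)%O.
  rewrite lt_neqAle -mE; apply/andP; split.
    apply: contra_neq a'0 => e; apply/eqP.
    by rewrite -mleadc_eq0 e mcoeffB tb_coef subrr.
  by apply: le_trans (mleadB_le _ _) _; rewrite tb_lead joinxx.
have [q qE] := IH _ lt _ erefl aint'.
by exists (q + t); rewrite mulrDl -qE subrK.
Qed.

(** Integral elements are almost integral: [b^d] clears the denominators of all powers of [x], as
    the equation reduces powers from [d] on to lower ones. *)
Lemma integral_mpoly (x : K) d (r : nat -> {mpoly k[N]}) :
  x ^+ d = \sum_(i < d) (r i)%:F * x ^+ i -> exists f, x = f%:F.
Proof.
have [a [b [b0 xE]]] := frac_ex x => xd.
have B0 : b%:F != 0 :> K by rewrite tofrac_eq0.
have H n : exists q, (b ^+ d)%:F * x ^+ n = q%:F :> K.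
  elim/ltn_ind: n => n IH; have [nd|dn] := ltnP n d.
    exists (b ^+ (d - n) * a ^+ n).
    rewrite tofracM !tofracXn xE.
    exact: expr_mul_div (ltnW nd).
  have /boolp.choice[q qE] i : exists q, (i < d)%N ->
      (b ^+ d)%:F * x ^+ (i + (n - d)) = q%:F :> K.
    have [id|id] := ltnP i d; last by exists 0.
    have [|q qE] := IH (i + (n - d))%N; last by exists q.
    by rewrite -{2}(subnKC dn) ltn_add2r.
  exists (\sum_(i < d) r i * q i).
  rewrite -{1}(subnKC dn) exprD xd rmorph_sum big_distrl big_distrr /=.
  apply: eq_bigr => i _; rewrite tofracM -qE//.
  by rewrite exprD -!mulrA mulrCA.
have /boolp.choice[q qE] := H.
have [||f fE] := @almost_integral_mpoly a b (b ^+ d) _ b0.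
- by rewrite expf_neq0.
- move=> n; exists (q n); apply/eqP; rewrite -tofrac_eq !tofracM -qE xE.
  by rewrite (tofracXn n a) (tofracXn n b) (mul_expr_div _ _ _ B0).
- by exists f; rewrite xE fE tofracM mulfK.
Qed.

End PolynomialRingNormal.

Section WeightedOrder.
Variables (k : fieldType) (N : nat) (w : 'I_N -> nat).
Local Notation K := (funfield k N).
Implicit Types (f g : {mpoly k[N]}).

Definition wge (n : nat) f := forall m, (wdot w m < n)%N -> f@_m = 0.

Definition word f : nat :=
  xget 0%N [set n | wge n f /\ exists2 m, wdot w m = n & f@_m != 0].

Lemma wordP f : f != 0 ->
  wge (word f) f /\ exists2 m, wdot w m = word f & f@_m != 0.
Proof.
move=> f0.
have [h hP] : exists h, least_weight [set m | f@_m != 0] h.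
  by apply: least_weight_exists; exists (mlead f); rewrite /= mleadc_eq0.
have := xgetPex 0%N (P := [set n | wge n f /\ exists2 m, wdot w m = n & f@_m != 0]).
apply; exists (h w); have [le [m m1 m2]] := hP w; split; last by exists m.
move=> m' lt; apply/eqP; apply: contraTT lt => /le.
by rewrite -leqNgt.
Qed.

Lemma wge_word n f : f != 0 -> wge n f <-> (n <= word f)%N.
Proof.
move=> f0; have [fge [m mw mf]] := wordP f0; split=> [nf|le m' lt].
  by rewrite leqNgt -mw; apply/negP => /nf /eqP; rewrite (negPf mf).
by apply: fge; exact: leq_trans lt le.
Qed.

Lemma word_eq n f m : wge n f -> wdot w m = n -> f@_m != 0 -> word f = n.
Proof.
move=> nf mn mf; have f0 : f != 0 by apply: contraNneq mf => ->; rewrite mcoeff0.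
apply/eqP; rewrite eqn_leq (iffLR (wge_word _ f0) nf) andbT.
rewrite leqNgt -mn; apply/negP => lt.
by have [/(_ _ lt) /eqP] := wordP f0; rewrite (negPf mf).
Qed.

Lemma wgeD n f g : wge n f -> wge n g -> wge n (f + g).
Proof. by move=> nf ng m lt; rewrite mcoeffD nf// ng// addr0. Qed.

Lemma wgeN n f : wge n f -> wge n (- f).
Proof. by move=> nf m lt; rewrite mcoeffN nf// oppr0. Qed.

Lemma wgeW n n' f : (n <= n')%N -> wge n' f -> wge n f.
Proof. by move=> le nf m lt; apply: nf; exact: leq_trans lt le. Qed.

Lemma wgeM n n' f g : wge n f -> wge n' g -> wge (n + n') (f * g).
Proof.
move=> nf ng m lt; rewrite mcoeffM big1// => -[a b] /eqP /= e.
have [an|an] := ltnP (wdot w a) n; first by rewrite nf// mul0r.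
rewrite ng ?mulr0//; move: lt (congr1 (wdot w) e); rewrite wdotD; lia.
Qed.

(** The initial forms, made of the terms of least weight, have a nonzero product; any monomial of it
    witnesses the order of [f * g]. *)
Lemma wordM f g : f != 0 -> g != 0 -> word (f * g) = (word f + word g)%N.
Proof.
move=> f0 g0; pose init n (h : {mpoly k[N]}) : {mpoly k[N]} :=
  \sum_(m <- msupp h | wdot w m == n) h@_m *: 'X_[m].
have initE n h m : (init n h)@_m = if wdot w m == n then h@_m else 0.
  rewrite /init raddf_sum /=.
  under eq_bigr do rewrite mcoeffZ mcoeffX.
  have [mh|mh] := boolP (m \in msupp h).
    rewrite big_mkcond (bigD1_seq m) ?msupp_uniq//= eqxx mulr1.
    rewrite big1 ?addr0// => j jm; rewrite (negPf jm) mulr0.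
    by case: ifP.
  rewrite big1_seq => [|j /andP[_ jh]].
    by rewrite (memN_msupp_eq0 mh); case: ifP.
  have -> : (j == m) = false by apply: contraNF mh => /eqP <-.
  by rewrite mulr0.
have [fge [mf mf1 mf2]] := wordP f0; have [gge [mg mg1 mg2]] := wordP g0.
have i0 h : h != 0 -> init (word h) h != 0.
  move=> h0; have [_ [m m1 m2]] := wordP h0; apply: contraNneq m2 => e.
  by have := initE (word h) h m; rewrite e mcoeff0 m1 eqxx => <-.
have := mulf_neq0 (i0 _ f0) (i0 _ g0); rewrite -mleadc_eq0.
move: (mlead _) => m mne.
have wm : wdot w m = (word f + word g)%N.
  apply: contraNeq mne => ne; rewrite mcoeffM big1// => -[a b] /eqP /= e.
  rewrite !initE; case: eqP => wa; last by rewrite mul0r.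
  case: eqP => wb; last by rewrite mulr0.
  by move: ne (congr1 (wdot w) e); rewrite wdotD wa wb => /eqP.
apply: (@word_eq _ _ m) => //; first exact: wgeM.
move: mne; rewrite !mcoeffM; congr (_ != _).
apply: eq_bigr => -[a b] /eqP /= e; rewrite !initE.
have := congr1 (wdot w) e; rewrite wm wdotD => wab.
have [wa|wa|wa] := ltngtP (wdot w a) (word f).
- by rewrite fge ?mul0r.
- by rewrite mul0r gge ?mulr0//; lia.
- by case: eqP => [//|]; lia.
Qed.

Lemma wordX m : word 'X_[m] = wdot w m.
Proof.
apply: (@word_eq _ _ m) => //; last by rewrite mcoeffX eqxx oner_neq0.
by move=> m'; rewrite mcoeffX; case: eqP => [->|//]; rewrite ltnn.
Qed.

Lemma word1 : word 1 = 0%N.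
Proof.
by rewrite -mpolyX0 wordX /wdot big1// => i _; rewrite mnm0E muln0.
Qed.

(** Computed on the fraction chosen by [repr]; [wval_div] is independence of that choice. *)
Definition wval (x : K) : int := (word \n_(repr x))%:Z - (word \d_(repr x))%:Z.

Lemma wval_div f g : f != 0 -> g != 0 ->
  wval (f%:F / g%:F) = (word f)%:Z - (word g)%:Z.
Proof.
move=> f0 g0; rewrite /wval; have := frac_reprE (f%:F / g%:F).
have := denom_ratioP (repr (f%:F / g%:F)).
move: (\n_(repr _)) (\d_(repr _)) => c d d0 rE.
have fd : f * d = c * g.
  by apply/eqP; rewrite -tofrac_eq !tofracM -eqr_div ?tofrac_eq0// rE.
have c0 : c != 0.
  apply: contra_neq (mulf_neq0 f0 d0) => c0; by rewrite fd c0 mul0r.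
by have := congr1 word fd; rewrite !wordM//; lia.
Qed.

Lemma wval_tofrac f : f != 0 -> wval f%:F = word f.
Proof.
by move=> f0; rewrite -[f%:F]divr1 -tofrac1 wval_div ?oner_neq0// word1 subr0.
Qed.

Lemma frac_neq0_ex (x : K) : x != 0 ->
  exists f g, [/\ f != 0, g != 0 & x = f%:F / g%:F].
Proof.
move=> x0; have [f [g [g0 xE]]] := frac_ex x; exists f, g; split=> //.
by apply: contra_neq x0 => f0; rewrite xE f0 tofrac0 mul0r.
Qed.

Lemma wvalM x y : x != 0 -> y != 0 -> wval (x * y) = wval x + wval y.
Proof.
move=> /frac_neq0_ex[a [b [a0 b0 ->]]] /frac_neq0_ex[c [d [c0 d0 ->]]].
rewrite mulf_div -!tofracM !wval_div ?mulf_neq0// !wordM//; lia.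
Qed.

Lemma wvalD x y : x != 0 -> y != 0 -> x + y != 0 ->
  Num.min (wval x) (wval y) <= wval (x + y).
Proof.
move=> /frac_neq0_ex[a [b [a0 b0 ->]]] /frac_neq0_ex[c [d [c0 d0 ->]]].
rewrite addf_div ?tofrac_eq0// -!tofracM -tofracD => s0.
have s0' : a * d + c * b != 0.
  by apply: contra_neq s0 => ->; rewrite tofrac0 mul0r.
rewrite !wval_div ?mulf_neq0// wordM//.
have : wge (minn (word (a * d)) (word (c * b))) (a * d + c * b).
  by apply: wgeD; apply/wge_word; rewrite ?mulf_neq0// ?geq_minl ?geq_minr.
move/(wge_word _ s0'); rewrite !wordM// minEle.
move: (word (_ + _)) (word a) (word b) (word c) (word d) => s n1 n2 n3 n4.
by case: ifPn; rewrite /minn; case: ltnP; lia.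
Qed.

Lemma vge_tofrac n f : wge n f -> vge wval n%:Z f%:F.
Proof.
move=> nf; have [->|f0] := eqVneq f 0; first by rewrite tofrac0 vge0.
rewrite vgeE ?tofrac_eq0// wval_tofrac//.
by have := iffLR (wge_word _ f0) nf; lia.
Qed.

(** Monomials are eigenvectors of the logarithmic derivation, so it preserves the weight filtration,
    which the partial derivative itself does not. *)
Lemma mcoeff_logderiv j f m : ('X_j * f^`M(j))@_m = f@_m *+ m j.
Proof.
have [mj|mj] := boolP (U_(j) <= m)%MM.
  rewrite mulrC -{1}(submK mj) addmC mcoeffMX mcoeff_deriv submK//.
  congr (_ *+ _); move: mj; rewrite lep1mP mnmBE mnm1E eqxx subn1 => mj.
  by rewrite prednK// lt0n.
have -> : m j = 0%N by move: mj; rewrite lep1mP negbK => /eqP.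
rewrite mulr0n mcoeffM big1// => -[a b] /eqP /= e.
rewrite mcoeffX; case: eqP => [ea|]; last by rewrite mul0r.
have : (U_(j) <= a + b)%MM by rewrite -ea lem_addr.
by rewrite -e (negPf mj).
Qed.

Lemma wge_logderiv n j f : wge n f -> wge n ('X_j * f^`M(j)).
Proof. by move=> nf m lt; rewrite mcoeff_logderiv nf// mul0rn. Qed.

Definition euler f := \sum_j ('X_j * f^`M(j)) *+ w j.

Lemma mcoeff_euler f m : (euler f)@_m = f@_m *+ wdot w m.
Proof.
rewrite /euler raddf_sum /= /wdot -sumrMnr; apply: eq_bigr => j _.
by rewrite mcoeffMn mcoeff_logderiv -mulrnA mulnC.
Qed.

(** On the initial form [euler] is multiplication by the weight [word f], so only terms of higher
    weight survive in the difference. *)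
Lemma wge_euler f : wge (word f).+1 (euler f - f *+ word f).
Proof.
have [->|f0] := eqVneq f 0.
  move=> m _; rewrite mcoeffB mcoeff_euler mcoeffMn mcoeff0 !mul0rn; exact: subrr.
have [fge _] := wordP f0 => m; rewrite ltnS leq_eqVlt mcoeffB mcoeff_euler mcoeffMn.
by move=> /orP[/eqP->|/fge ->]; rewrite ?mul0rn subrr.
Qed.

End WeightedOrder.

(** * Toric divisors *)

(** Modulo elements of positive order, [M] kills the vector [w], which is nonzero there by the
    Bezout relation. The adjugate shows that each [det M * w_j] has positive order, and the [c_j]
    recombine these products without inverting any [w_j]. *)
Lemma vge_det_unimodular (K : fieldType) (v : K -> int)
  (vM : forall x y, x != 0 -> y != 0 -> v (x * y) = v x + v y)
  (vD : forall x y, x != 0 -> y != 0 -> x + y != 0 ->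
     Num.min (v x) (v y) <= v (x + y))
  N (M : 'M[K]_N) (w c : 'I_N -> K) :
  (forall i j, vge v 0 (M i j)) -> (forall j, vge v 0 (c j)) ->
  \sum_j c j * w j = 1 -> (forall i, vge v 1 (\sum_j M i j * w j)) ->
  vge v 1 (\det M).
Proof.
move=> M0 c0 cw Mw.
have adj0 i j : vge v 0 (\adj M i j).
  rewrite mxE /cofactor -signr_odd.
  have h : vge v 0 (\det (row' j (col' i M))).
    have := vge_det vM vD (n := fun=> 0) (M := row' j (col' i M)).
    by rewrite sumr_const mul0rn; apply=> a b; rewrite !mxE.
  by case: (odd _); rewrite ?expr0 ?expr1 ?mul1r// mulN1r; exact: (vgeN vM).
have detw j : vge v 1 (\det M * w j).
  have -> : \det M * w j = \sum_i \adj M j i * \sum_l M i l * w l.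
    transitivity (((\adj M *m M) *m (\col_l w l)) j 0).
      by rewrite mul_adj_mx mul_scalar_mx !mxE.
    rewrite -mulmxA [LHS]mxE; apply: eq_bigr => i _; congr (_ * _).
    by rewrite [LHS]mxE; apply: eq_bigr => l _; rewrite [in LHS]mxE.
  by apply: (vge_sum vD) => i _; rewrite -[1]add0r; apply: (vgeM vM).
have -> : \det M = \sum_j c j * (\det M * w j).
  rewrite -[LHS]mulr1 -cw big_distrr; apply: eq_bigr => j _.
  by rewrite mulrCA.
by apply: (vge_sum vD) => j _; rewrite -[1]add0r; apply: (vgeM vM).
Qed.

Section LaurentMonomials.
Variables (F : fieldType) (N : nat) (x : 'I_N -> F).
Hypothesis x0 : forall i, x i != 0.

Definition lmon (m : 'I_N -> int) : F := \prod_i x i ^ m i.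

Lemma lmon_neq0 m : lmon m != 0.
Proof. by apply/prodf_neq0 => i _; rewrite expfz_neq0. Qed.

Lemma lmonD m m' : lmon (fun i => m i + m' i) = lmon m * lmon m'.
Proof. by rewrite /lmon -big_split; apply: eq_bigr => i _; rewrite expfzDr. Qed.

Lemma lmon0 : lmon (fun=> 0) = 1.
Proof. by rewrite /lmon big1// => i _; rewrite expr0z. Qed.

Lemma lmonN m : lmon (fun i => - m i) = (lmon m)^-1.
Proof.
apply: (mulfI (lmon_neq0 m)); rewrite -lmonD mulfV ?lmon_neq0// -lmon0.
by congr lmon; apply/funext => i; rewrite subrr.
Qed.

Lemma lmonZ m (z : int) : lmon (fun i => m i * z) = lmon m ^ z.
Proof.
apply: (big_ind2 (fun a b => a = b ^ z)) => [|a b a' b' -> ->|i _].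
- by rewrite exp1rz.
- by rewrite expfzMl.
- by rewrite exprz_exp.
Qed.

Lemma lmon_sum (I : finType) (m : I -> 'I_N -> int) :
  lmon (fun i => \sum_l m l i) = \prod_l lmon (m l).
Proof.
rewrite /lmon exchange_big; apply: eq_bigr => i _.
apply: (big_ind2 (fun a b => x i ^ a = b)) => [|a b a' b' <- <-|//].
  by rewrite expr0z.
by rewrite expfzDr.
Qed.

Lemma lmon_nat (m : 'X_{1..N}) : lmon (fun i => (m i)%:Z) = \prod_i x i ^+ m i.
Proof. by []. Qed.

Lemma val_lmon (v : F -> int)
  (vM : forall a b, a != 0 -> b != 0 -> v (a * b) = v a + v b) m :
  v (lmon m) = \sum_i m i * v (x i).
Proof.
have vxz i (z : int) : v (x i ^ z) = z * v (x i).
  case: z => n; first by rewrite -exprnP (valX vM)// mulrC -mulr_natr natz.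
  rewrite NegzE -exprnN (valV vM) ?expf_neq0//.
  by rewrite (valX vM)// mulNr mulrC -mulr_natr natz.
pose Q (a : F) (b : int) := a != 0 /\ v a = b.
suff : Q (lmon m) (\sum_i m i * v (x i)) by case.
apply: (big_ind2 Q) => [|a b a' b' [a0 <-] [a'0 <-]|i _].
- by split; [exact: oner_neq0|exact: (val1 vM)].
- by split; [exact: mulf_neq0|exact: vM].
- by split; [rewrite expfz_neq0|exact: vxz].
Qed.

End LaurentMonomials.

Section Toric.
Variables (k : fieldType) (N : nat) (w : 'I_N -> nat).
Local Notation K := (funfield k N).
Local Notation v := (@wval k N w).
Local Notation X := (fun i : 'I_N => ('X_i)%:F : K).
Local Notation mon := (lmon X).

Let X0 : forall i, X i != 0 := @tofracX_neq0 k N.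
Let vM := @wvalM k N w.
Let vD := @wvalD k N w.

Lemma tofracX_lmon (m : 'X_{1..N}) : ('X_[m])%:F = mon (fun i => (m i)%:Z).
Proof.
rewrite lmon_nat mpolyXE_id rmorph_prod; apply: eq_bigr => i _.
exact: tofracXn.
Qed.

Lemma mpolyX_neq0 (m : 'X_{1..N}) : 'X_[m] != 0 :> {mpoly k[N]}.
Proof. by rewrite -mleadc_eq0 mleadXm mcoeffX eqxx oner_neq0. Qed.

Lemma wval_lmon m : v (mon m) = \sum_i m i * (w i)%:Z.
Proof.
have vX i : v (X i) = (w i)%:Z.
  rewrite wval_tofrac ?mpolyX_neq0// wordX /wdot (bigD1 i)//= mnm1E eqxx muln1.
  by rewrite big1 ?addn0// => j ji; rewrite mnm1E eq_sym (negPf ji) muln0.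
rewrite (val_lmon X0 vM); apply: eq_bigr => i _; congr (_ * _).
exact: vX.
Qed.

Definition laurent (x : K) :=
  exists (s : 'X_{1..N}) (f : {mpoly k[N]}), ('X_[s])%:F * x = f%:F.

Lemma laurent_tofrac f : laurent f%:F.
Proof. by exists 0%MM, f; rewrite mpolyX0 tofrac1 mul1r. Qed.

Lemma laurentD x y : laurent x -> laurent y -> laurent (x + y).
Proof.
move=> [s [f fE]] [t [g gE]]; exists (s + t)%MM, ('X_[t] * f + 'X_[s] * g).
rewrite mpolyXD tofracD !tofracM -fE -gE.
by rewrite mulrDr [_ * ('X_[t])%:F]mulrC -!mulrA; congr (_ + _); rewrite mulrCA.
Qed.

Lemma laurentM x y : laurent x -> laurent y -> laurent (x * y).
Proof.
move=> [s [f fE]] [t [g gE]]; exists (s + t)%MM, (f * g).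
by rewrite mpolyXD !tofracM -fE -gE mulrACA.
Qed.

Lemma laurent_lmon m : laurent (mon m).
Proof.
exists [multinom absz (m i) | i < N],
  'X_[[multinom absz (m i + (absz (m i))%:Z)%R | i < N]].
rewrite !tofracX_lmon -(lmonD X0); congr lmon; apply/funext => i.
rewrite !mnmE; lia.
Qed.

Lemma vge_const (f : {mpoly k[N]}) : vge v 0 f%:F.
Proof. exact: (@vge_tofrac _ _ _ 0%N). Qed.

(** The semigroup algebra of the exponents in the half-space [<m, w> >= 0]: the affine toric chart
    of the ray spanned by [w]. *)
Definition half_laurent : set K := [set x | laurent x /\ vge v 0 x].

Lemma half_laurentD x y : half_laurent x -> half_laurent y -> half_laurent (x + y).
Proof.
move=> [x1 x2] [y1 y2]; split; [exact: laurentD|exact: (vgeD vD)].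
Qed.

Lemma half_laurentM x y : half_laurent x -> half_laurent y -> half_laurent (x * y).
Proof.
move=> [x1 x2] [y1 y2]; split; first exact: laurentM.
by rewrite -[0]addr0; exact: (vgeM vM).
Qed.

Lemma half_laurent_lmon m : 0 <= \sum_i m i * (w i)%:Z -> half_laurent (mon m).
Proof.
move=> m0; split; first exact: laurent_lmon.
by rewrite vgeE ?lmon_neq0 ?wval_lmon//; exact: X0.
Qed.

Lemma half_laurent_tofrac f : half_laurent f%:F.
Proof. by split; [exact: laurent_tofrac|exact: vge_const]. Qed.

Variable c : 'I_N -> int.
Hypothesis cw : \sum_i c i * (w i)%:Z = 1.

(* By Bezout, the exponents of weight zero are generated by the Koszul relations
   [w_j e_i - w_i e_j]; with a monomial of weight one they generate the exponents
   of nonnegative weight. *)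
Definition koszul (i j : 'I_N) (l : 'I_N) : int :=
  (w j)%:Z * (l == i)%:R - (w i)%:Z * (l == j)%:R.

Definition toric_gen_expo (o : option ('I_N * 'I_N)) : 'I_N -> int :=
  if o is Some ij then koszul ij.1 ij.2 else c.

Definition toric_gen (l : 'I_#|{: option ('I_N * 'I_N)}|) : K :=
  mon (toric_gen_expo (enum_val l)).

Lemma toric_gen_mem o : gen_subalg toric_gen (mon (toric_gen_expo o)).
Proof.
by have := gen_subalg_gen toric_gen (enum_rank o); rewrite /toric_gen enum_rankK.
Qed.

Lemma koszul_weight i j : \sum_l koszul i j l * (w l)%:Z = 0.
Proof.
rewrite /koszul; under eq_bigr do rewrite mulrBl -!mulrA.
have delta a : \sum_l (l == a)%:R * (w l)%:Z = (w a)%:Z.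
  rewrite (bigD1 a)//= eqxx mul1r big1 ?addr0// => l /negPf ->.
  by rewrite mul0r.
by rewrite sumrB -!big_distrr /= !delta mulrC subrr.
Qed.

(** Subtracting [h c] leaves an exponent [m0] of weight zero. On such exponents contraction with [c]
    inverts the Koszul map: the sum of the [c_j m0_i (w_j e_i - w_i e_j)] is
    [(c.w) m0 - (m0.w) c = m0]. *)
Lemma koszul_decomp (m : 'I_N -> int) l :
  m l = (\sum_i m i * (w i)%:Z) * c l +
    \sum_(p : 'I_N * 'I_N) koszul p.1 p.2 l *
      (c p.2 * (m p.1 - (\sum_i m i * (w i)%:Z) * c p.1)).
Proof.
set h := \sum_i _; pose m0 i := m i - h * c i.
have m0w : \sum_i m0 i * (w i)%:Z = 0.
  rewrite /m0; under eq_bigr do rewrite mulrBl -mulrA.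
  by rewrite sumrB -big_distrr /= cw mulr1 subrr.
suff -> : \sum_(p : 'I_N * 'I_N) koszul p.1 p.2 l * (c p.2 * m0 p.1) = m0 l.
  by rewrite addrC subrK.
rewrite -(pair_bigA _ (fun i j => koszul i j l * (c j * m0 i))) /=.
transitivity (\sum_i \sum_j ((l == i)%:R * m0 i * (c j * (w j)%:Z) -
    (l == j)%:R * c j * (m0 i * (w i)%:Z))).
  by apply: eq_bigr => i _; apply: eq_bigr => j _; rewrite /koszul; ring.
under eq_bigr do rewrite sumrB -big_distrr /= cw mulr1 -big_distrl /=.
rewrite sumrB -big_distrr /= m0w mulr0 subr0 (bigD1 l)//= eqxx mul1r.
by rewrite big1 ?addr0// => i /negPf il; rewrite eq_sym il mul0r.
Qed.

Lemma gen_subalg_lmon m : 0 <= \sum_i m i * (w i)%:Z ->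
  gen_subalg toric_gen (mon m).
Proof.
move=> m0; rewrite (funext (koszul_decomp m)).
move: (\sum_i _) m0 => h h0; rewrite (lmonD X0); apply: gen_subalgM.
  have -> : (fun l => h * c l) = (fun l => c l * h).
    by apply/funext => l; rewrite mulrC.
  rewrite (lmonZ X); case: h h0 => // n _; apply: gen_subalgX.
  exact: (toric_gen_mem None).
rewrite (lmon_sum X0); apply: (big_ind (gen_subalg toric_gen)).
- exact: gen_subalg1.
- by move=> x y; exact: gen_subalgM.
move=> [i j] _ /=; rewrite (lmonZ X); case: (_ * _) => n.
  by apply: gen_subalgX; exact: (toric_gen_mem (Some (i, j))).
(* The inverse of a Koszul generator is again one, with [i] and [j] exchanged, so negative
   coefficients are harmless. *)
rewrite NegzE -exprnN -exprVn -(lmonN X0); apply: gen_subalgX.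
have -> : (fun l => - koszul i j l) = koszul j i.
  by apply/funext => l; rewrite /koszul opprB.
exact: (toric_gen_mem (Some (j, i))).
Qed.

(** The order of a Laurent polynomial is the least weight of its terms, so nonnegative order places
    every term in the half-space. *)
Lemma gen_subalg_toric : gen_subalg toric_gen = half_laurent.
Proof.
apply/seteqP; split.
  apply: gen_subalg_ind.
  - by move=> a; exact: half_laurent_tofrac.
  - move=> l; apply: half_laurent_lmon; case: (enum_val l) => [[i j]|] /=.
      by rewrite koszul_weight.
    by rewrite cw.
  - exact: half_laurentD.
  - exact: half_laurentM.
move=> x [[s [f fE]] x0]; have Xs0 : ('X_[s])%:F != 0 :> K.
  by rewrite tofrac_eq0 mpolyX_neq0.
have fw : wge w (wdot w s) f.
  have [f0|f0] := eqVneq f 0; first by rewrite f0 => m _; exact: mcoeff0.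
  apply/wge_word => //; have xn0 : x != 0.
    apply: contra_neq f0 => xe; move: fE; rewrite xe mulr0 => /esym/eqP.
    by rewrite tofrac_eq0 => /eqP.
  have := congr1 v fE; rewrite vM// !wval_tofrac ?mpolyX_neq0// wordX.
  by move: x0; rewrite vgeE//; lia.
have -> : x = \sum_(m <- msupp f) ((f@_m)%:MP)%:F * mon (fun i => (m i)%:Z - (s i)%:Z).
  apply: (mulfI Xs0); rewrite fE {1}[f]mpolyE rmorph_sum big_distrr /=.
  apply: eq_bigr => m _; rewrite -mul_mpolyC tofracM mulrCA; congr (_ * _).
  rewrite !tofracX_lmon -(lmonD X0); congr lmon; apply/funext => i.
  by rewrite addrC subrK.
rewrite big_seq; apply: (big_ind (gen_subalg toric_gen)).
- exact: gen_subalg0.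
- by move=> y z; exact: gen_subalgD.
move=> m; rewrite mcoeff_msupp => mf; apply: gen_subalgM.
  exact: gen_subalgC.
apply: gen_subalg_lmon; have : (wdot w s <= wdot w m)%N.
  by rewrite leqNgt; apply: contra mf => /fw ->.
under eq_bigr do rewrite mulrBl; rewrite sumrB subr_ge0.
have wdotE (u : 'X_{1..N}) : \sum_i (u i)%:Z * (w i)%:Z = (wdot w u)%:Z.
  rewrite -[RHS]natz natr_sum; apply: eq_bigr => i _.
  by rewrite natrM !natz mulrC.
by rewrite !wdotE.
Qed.

End Toric.

Lemma integral_vge (K : fieldType) (v : K -> int)
  (vM : forall x y, x != 0 -> y != 0 -> v (x * y) = v x + v y)
  (vD : forall x y, x != 0 -> y != 0 -> x + y != 0 ->
     Num.min (v x) (v y) <= v (x + y)) (x : K) d (r : nat -> K) :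
  (forall i, (i < d)%N -> vge v 0 (r i)) ->
  x ^+ d = \sum_(i < d) r i * x ^+ i -> vge v 0 x.
Proof.
move=> r0 xd; have [->|x0] := eqVneq x 0; first exact: vge0.
rewrite vgeE// leNgt; apply/negP => vx.
case: d r0 xd => [|d] r0 xd.
  by move/eqP: xd; rewrite expr0 big_ord0 oner_eq0.
have : vge v (v x *+ d) (x ^+ d.+1).
  rewrite xd; apply: (vge_sum vD) => i _.
  have xi : vge v (v x *+ i) (x ^+ i) by apply: (vge_exp vM); rewrite vgeE.
  apply: vgeW (vgeM vM (r0 i (ltn_ord i)) xi); rewrite add0r.
  have -> : v x *+ d = v x *+ i + v x *+ (d - i).
    by rewrite -mulrnDr subnKC// -ltnS.
  by rewrite gerDl mulrn_wle0// ltW.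
by rewrite vgeE ?expf_neq0// (valX vM)// mulrS lerDr leNgt vx.
Qed.

Lemma vge1_mul (K : fieldType) (v : K -> int)
  (vM : forall x y, x != 0 -> y != 0 -> v (x * y) = v x + v y) (x y : K) :
  vge v 0 x -> vge v 0 y -> vge v 1 (x * y) -> vge v 1 x \/ vge v 1 y.
Proof.
have [->|x0] := eqVneq x 0; first by left; exact: vge0.
have [->|y0] := eqVneq y 0; first by right; exact: vge0.
rewrite !vgeE ?mulf_neq0// vM// => vx vy vxy.
have [x1|x1] := leP 1 (v x); [by left|right; lia].
Qed.

Lemma expr_clear_denominator (F : fieldType) (t q x : F) d i : (i < d)%N ->
  t ^+ d * (q * x ^+ i) = t ^+ (d - i.+1) * (t * q) * (t * x) ^+ i.
Proof.
move=> id; rewrite -{1}(subnK id) exprD exprS exprMn.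
by rewrite -!mulrA; congr (_ * (_ * _)); rewrite mulrCA.
Qed.

Lemma monic_root_expr (F : fieldType) (q : {poly F}) x : q \is monic ->
  root q x -> x ^+ (size q).-1 = \sum_(i < (size q).-1) - q`_i * x ^+ i.
Proof.
move=> /monicP qm /rootP.
have q0 : (size q <= (size q).-1.+1)%N by rewrite leqSpred.
rewrite (horner_coef_wide _ q0) big_ord_recr /= -lead_coefE qm mul1r addrC => /eqP.
rewrite addr_eq0 => /eqP ->; rewrite -sumrN.
by apply: eq_bigr => i _; rewrite mulNr.
Qed.

Lemma euler_quotient_rule (A : comNzRingType) (a b ea eb : A) (n m : nat) :
  ea * b - a * eb =
  (ea - a *+ (n + m)) * b - a * (eb - b *+ n) + (a * b) *+ m.
Proof.
rewrite mulrBl mulrBr mulrnAl mulrnAr mulrnDr.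
by move: (ea * b) (a * eb) (a * b *+ n) (a * b *+ m) => *; ring.
Qed.

Section ToricDivisor.
Variables (k : fieldType) (N : nat) (w : 'I_N -> nat) (c : 'I_N -> int).
Hypothesis cw : \sum_i c i * (w i)%:Z = 1.
Local Notation K := (funfield k N).
Local Notation v := (@wval k N w).
Local Notation X := (fun i : 'I_N => ('X_i)%:F : K).
Local Notation mon := (lmon X).
Local Notation B := (@half_laurent k N w).

Let vM := @wvalM k N w.
Let vD := @wvalD k N w.

(** The chart is the intersection of a valuation ring with the Laurent polynomials. For the latter,
    a monomial [t] clearing the coefficients makes [t x] integral over the polynomial ring, which is
    normal. *)
Lemma half_laurent_integrally_closed : integrally_closed B.
Proof.
move=> q x qm qB /(monic_root_expr qm); set d := (size q).-1 => xd.
split; last first.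
  apply: (integral_vge vM vD (r := fun i => - q`_i) _ xd) => i _.
  by apply: (vgeN vM); exact: (qB i).2.
have /boolp.choice[s /boolp.choice[f fE]] i : exists s f,
    ('X_[s])%:F * q`_i = f%:F :> K by have [] := qB i.
pose S := (\sum_(i < d) s i)%MM; pose t : K := ('X_[S])%:F.
have /boolp.choice[g gE] i : exists g, (i < d)%N -> t * q`_i = g%:F.
  have [id|] := ltnP i d; last by exists 0.
  exists ('X_[S - s i] * f i) => _; rewrite tofracM -fE mulrA -tofracM -mpolyXD.
  by rewrite submK// /S (bigD1 (Ordinal id))//= lem_addr.
have [|h hE] := @integral_mpoly k N (t * x) d (fun i => - ('X_[S] ^+ (d - i.+1) * g i)).
  rewrite exprMn xd big_distrr; apply: eq_bigr => i _ /=.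
  rewrite tofracN tofracM tofracXn -/t -gE// !mulNr mulrN; congr (- _).
  exact: expr_clear_denominator.
by exists S, h.
Qed.

Definition toric_prime : set K := [set x | B x /\ vge v 1 x].

Lemma half_laurent0 : B 0.
Proof. by rewrite -tofrac0; exact: half_laurent_tofrac. Qed.

Lemma toric_primeP : prime_ideal_of B toric_prime.
Proof.
split.
- by move=> x [].
- split; first by split; [exact: half_laurent0|exact: vge0].
  by case=> _; rewrite vgeE ?oner_neq0// (val1 vM).
- move=> x y [Bx x1] [By y1].
  by split; [exact: half_laurentD|exact: (vgeD vD)].
- move=> x y Bx [By y1]; split; first exact: half_laurentM.
  by rewrite -[1]add0r; apply: (vgeM vM) => //; case: Bx.
- move=> x y Bx By [_ xy1].
  by have [x1|y1] := vge1_mul vM Bx.2 By.2 xy1; [left|right].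
Qed.

(** Powers of a uniformizer that is a Laurent monomial: multiplication by them shifts the order at
    will without leaving the Laurent polynomials. *)
Let Y (z : int) : K := mon (fun i => c i * z).

Let Y_neq0 z : Y z != 0.
Proof. exact: lmon_neq0 (@tofracX_neq0 k N) _. Qed.

Let Y_weight z : \sum_i c i * z * (w i)%:Z = z.
Proof.
under eq_bigr do rewrite mulrAC.
by rewrite -big_distrl /= cw mul1r.
Qed.

Let vY z : v (Y z) = z.
Proof. by rewrite /Y wval_lmon Y_weight. Qed.

Let YD z z' : Y (z + z') = Y z * Y z'.
Proof.
rewrite /Y -(lmonD (@tofracX_neq0 k N)); congr lmon; apply/funext => i.
by rewrite mulrDr.
Qed.

Let Y0 : Y 0 = 1.
Proof.
by rewrite /Y -(lmon0 X); congr lmon; apply/funext => i; rewrite mulr0.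
Qed.

Let laurentY z : laurent (Y z).
Proof. exact: laurent_lmon. Qed.

Let BY z : 0 <= z -> B (Y z).
Proof. by move=> z0; split=> //; rewrite vgeE ?Y_neq0 ?vY. Qed.

Let mulY_neq0 (x : K) z : x != 0 -> x * Y z != 0.
Proof. by move=> x0; exact: mulf_neq0 x0 (Y_neq0 z). Qed.

Let vMY (x : K) z : x != 0 -> v (x * Y z) = v x + z.
Proof. by move=> x0; rewrite (vM x0 (Y_neq0 z)) vY. Qed.

Let vge_MY (x : K) n z : x != 0 -> vge v n (x * Y z) = (n <= v x + z).
Proof. by move=> x0; rewrite (vgeE v n (mulY_neq0 z x0)) vMY. Qed.

Let mulYK x z : x * Y (- z) * Y z = x.
Proof. by rewrite -mulrA -YD addNr Y0 mulr1. Qed.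

(** For a nonzero [f] in [Q], the factor [f * Y (- v f)] has order 0 and lies outside [Q]. Primality
    puts [Y (v f)], then [Y 1], into [Q], and [Y 1] generates the toric prime. *)
Lemma toric_prime_height_one : height_one B toric_prime.
Proof.
have PY1 : toric_prime (Y 1) by split; [exact: BY|rewrite vgeE ?Y_neq0 ?vY].
split=> [P0|Q [QB [Q0 _] QD QM QP] QsubP].
  by have := Y_neq0 1; move: PY1; rewrite P0 => /= ->; rewrite eqxx.
have [Qe|Qn] := pselect (Q = [set 0]); first by left.
right; have [f [Qf f0]] : exists f, Q f /\ f != 0.
  apply: contrapT => nf; apply: Qn; apply/seteqP; split=> [f Qf|_ ->//].
  apply: contrapT => f0; apply: nf; exists f; split=> //; exact/eqP.
have Bf := QB _ Qf; have [_] := QsubP _ Qf; rewrite vgeE// => vf.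
have Bu : B (f * Y (- v f)).
  by split; [apply: laurentM => //; case: Bf|rewrite vge_MY// subrr].
have QY : Q (Y (v f)).
  have [|//|//] := QP _ _ Bu (BY (le_trans ler01 vf)).
    by rewrite mulYK.
  by move=> /QsubP[_]; rewrite vge_MY// subrr.
have {QY}QY : exists n : nat, Q (Y n.+1%:Z).
  by exists (absz (v f)).-1; rewrite prednK; [rewrite gez0_abs//|]; lia.
have QY1 : Q (Y 1).
  have [n] := QY; elim: n => [//|n IH].
  have -> : n.+2%:Z = 1 + n.+1%:Z by lia.
  by rewrite YD => /(QP _ _ (BY ler01) (BY (z := n.+1%:Z) isT))[].
apply/seteqP; split=> // g [Bg g1]; rewrite -[g](mulYK _ 1).
apply: QM => //; split; first by apply: laurentM => //; case: Bg.
by rewrite -[0](subrr 1); apply: (vgeM vM) => //; rewrite vgeE ?Y_neq0 ?vY.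
Qed.

Lemma toric_valuation : discrete_valuation_of (localization B toric_prime) v.
Proof.
split; [exact: vM|exact: vD|by exists (Y 1); [exact: Y_neq0|exact: vY]|].
move=> x x0; split=> [vx|[a [b [Ba Bb nPb xE]]]].
  have [f [g [f0 g0 xE]]] := frac_neq0_ex x0.
  have F0 : f%:F != 0 :> K by rewrite tofrac_eq0.
  have G0 : g%:F != 0 :> K by rewrite tofrac_eq0.
  (* Numerator and denominator are both divided by a monomial of the order of [g]: they enter the
     chart, and the denominator gets order 0. *)
  move: vx; rewrite xE wval_div// => vx; pose z := - (word w g)%:Z.
  exists (f%:F * Y z), (g%:F * Y z); split.
  - split; first by apply: laurentM => //; exact: laurent_tofrac.
    by rewrite (vge_MY 0 z F0) (wval_tofrac w f0); exact: vx.
  - split; first by apply: laurentM => //; exact: laurent_tofrac.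
    by rewrite (vge_MY 0 z G0) (wval_tofrac w g0) subrr.
  - by case=> _; rewrite (vge_MY 1 z G0) (wval_tofrac w g0) subrr.
  - by rewrite -mulf_div divff ?Y_neq0// mulr1.
have b0 : b != 0.
  by apply: contra_not_neq nPb => ->; have [_ []] := toric_primeP.
have a0 : a != 0 by apply: contra_neq x0 => a0; rewrite xE a0 mul0r.
have vb : v b = 0.
  have := Bb.2; rewrite vgeE// => vb; apply/eqP; rewrite eq_le vb andbT leNgt.
  by apply/negP => vb1; apply: nPb; split; rewrite // vgeE.
rewrite xE (vM a0 (invr_neq0 b0)) (valV vM b0) vb subr0.
by have := Ba.2; rewrite vgeE.
Qed.

End ToricDivisor.

(** A chart must be presented by generators, while its properties are proved for [half_laurent];
    they are transported along [e]. *)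
Definition toric_divisor (k : fieldType) N (w : 'I_N -> nat) (c : 'I_N -> int)
    (cw : \sum_i c i * (w i)%:Z = 1) : prime_divisor k N :=
  let e := gen_subalg_toric k cw in
  PrimeDivisor (pd_gen := @toric_gen k N w c) (pd_prime := toric_prime w)
    (pd_ord := wval w)
    (fun i => eq_ind_r (fun B => B ('X_i)%:F) (half_laurent_tofrac w 'X_i) e)
    (eq_ind_r integrally_closed (@half_laurent_integrally_closed k N w) e)
    (eq_ind_r (prime_ideal_of ^~ _) (@toric_primeP k N w) e)
    (eq_ind_r (height_one ^~ _) (toric_prime_height_one k cw) e)
    (eq_ind_r (fun B => discrete_valuation_of (localization B _) _)
      (toric_valuation k cw) e).

(** * Toric discrepancies and orders of monomial ideals *)

Lemma meval_origin (k : fieldType) N (f : {mpoly k[N]}) : f.@[fun=> 0] = f@_0%MM.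
Proof.
rewrite mevalE; have term (m : 'X_{1..N}) :
    m != 0%MM -> f@_m * \prod_i (0 : k) ^+ m i = 0.
  move=> m0; have [i mi] : exists i, m i != 0%N.
    apply: contrapT => nm; case/eqP: m0; apply/mnmP => i; rewrite mnm0E.
    by apply/eqP; apply: contrapT => /negP mi; apply: nm; exists i.
  by rewrite (bigD1 i)//= expr0n (negPf mi) mul0r mulr0.
have [f0|f0] := boolP (0%MM \in msupp f).
  rewrite (bigD1_seq 0%MM) ?msupp_uniq//= [X in _ + X]big1 => [|m m0]; last exact: term.
  by rewrite addr0 big1 ?mulr1// => i _; rewrite mnm0E expr0.
rewrite (memN_msupp_eq0 f0) big1_seq// => m /andP[_ mf]; apply: term.
by apply: contraNneq f0 => <-.
Qed.

Section LogDerivations.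
Variables (k : fieldType) (N : nat) (w : 'I_N -> nat).
Local Notation K := (funfield k N).
Local Notation v := (@wval k N w).

Let vM := @wvalM k N w.
Let vD := @wvalD k N w.

Lemma logderiv_div j (a b : {mpoly k[N]}) : b != 0 ->
  ('X_j)%:F * fderiv j (a%:F / b%:F) =
  ('X_j * a^`M(j) * b - a * ('X_j * b^`M(j)))%:F / (b ^+ 2)%:F.
Proof.
move=> b0; rewrite fderivE// mulrA -tofracM; congr (_%:F / _).
by rewrite mulrBr !mulrA ['X_j * a]mulrC.
Qed.

Lemma vge_div_sqr n (p b : {mpoly k[N]}) : b != 0 ->
  wge w (word w b + word w b + n) p -> vge v n%:Z (p%:F / (b ^+ 2)%:F).
Proof.
move=> b0 pn; have [p0|p0] := eqVneq p 0.
  by rewrite p0 tofrac0 mul0r; exact: vge0.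
have b20 : b ^+ 2 != 0 by exact: expf_neq0.
have pb0 : p%:F / (b ^+ 2)%:F != 0 :> K.
  by rewrite mulf_neq0 ?invr_eq0 ?tofrac_eq0.
rewrite (vgeE v n%:Z pb0) (wval_div w p0 b20).
have -> : word w (b ^+ 2) = (word w b + word w b)%N by rewrite expr2 wordM.
by have := iffLR (wge_word _ _ p0) pn; lia.
Qed.

Lemma vge_frac_ex (x : K) : vge v 0 x -> exists a b : {mpoly k[N]},
  [/\ b != 0, x = a%:F / b%:F & a = 0 \/ (word w b <= word w a)%N].
Proof.
have [->|x0] := eqVneq x 0.
  exists 0, 1; rewrite oner_neq0 tofrac0 mul0r; split=> //; by left.
rewrite (vgeE v 0 x0); have [a [b [a0 b0 xE]]] := frac_neq0_ex x0.
rewrite xE (wval_div w a0 b0) subr_ge0 => le.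
by exists a, b; split=> //; right.
Qed.

Lemma wge0 f : wge w (@word k N w f) f.
Proof.
by have [->|f0] := eqVneq f 0; [move=> m _; exact: mcoeff0|have [] := wordP w f0].
Qed.

Lemma vge_logderiv j (x : K) : vge v 0 x -> vge v 0 (('X_j)%:F * fderiv j x).
Proof.
move=> /vge_frac_ex[a [b [b0 -> ab]]]; rewrite logderiv_div//.
apply: (vge_div_sqr (n := 0%N) b0); rewrite addn0.
have aw : wge w (word w b) a.
  by case: ab => [->|ab]; [move=> m _; exact: mcoeff0|exact (wgeW ab (@wge0 a))].
apply: wgeD; first by apply: wgeM (@wge0 b); exact: wge_logderiv.
by apply: wgeN; apply: wgeM aw _; apply: wge_logderiv; exact: wge0.
Qed.

(** The Euler derivation scales the leading part of [a / b] by its order [word a - word b]. If this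
    is zero the leading part is killed; otherwise [x] already has positive order. *)
Lemma vge_euler (x : K) : vge v 0 x ->
  vge v 1 (\sum_j ('X_j)%:F * fderiv j x * (w j)%:R).
Proof.
move=> /vge_frac_ex[a [b [b0 -> ab]]].
have -> : \sum_j ('X_j)%:F * fderiv j (a%:F / b%:F) * (w j)%:R =
    (euler w a * b - a * euler w b)%:F / (b ^+ 2)%:F :> K.
  rewrite /euler big_distrl big_distrr -sumrB rmorph_sum big_distrl.
  apply: eq_bigr => j _ /=; rewrite logderiv_div// mulrAC; congr (_ / _).
  by rewrite mulrnAl mulrnAr -mulrnBl mulr_natr -rmorphMn.
apply: (vge_div_sqr (n := 1%N) b0); case: ab => [->|ab].
  rewrite mul0r subr0 => m _.
  have -> : euler w 0 = 0 :> {mpoly k[N]}.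
    by apply/mpolyP => m'; rewrite mcoeff_euler mcoeff0 mul0rn.
  by rewrite mul0r mcoeff0.
rewrite (euler_quotient_rule a b _ _ (word w b) (word w a - word w b)).
rewrite subnKC//; apply: wgeD; first apply: wgeD.
- by refine (wgeW _ (wgeM (@wge_euler k N w a) (@wge0 b))); lia.
- by apply: wgeN; refine (wgeW _ (wgeM (@wge0 a) (@wge_euler k N w b))); lia.
- have [e|ne] := eqVneq (word w a) (word w b).
    by rewrite e subnn mulr0n => m _; exact: mcoeff0.
  move=> m lt; rewrite mcoeffMn.
  by rewrite (wgeM (@wge0 a) (@wge0 b)) ?mul0rn//; move: lt ne ab; lia.
Qed.

Lemma vge_int (z : int) : vge v 0 (z%:~R : K).
Proof.
have -> : z%:~R = (z%:~R : {mpoly k[N]})%:F :> K by rewrite rmorph_int.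
exact: vge_const.
Qed.

(** Logarithmic derivations multiply the Jacobian by [X_1 ... X_N], of order [|w|], and [vge_euler]
    gains one more order. This bounds the discrepancy of the toric divisor from above by
    [|w| - 1]. *)
Lemma vge_jacobian (c : 'I_N -> int) (f : 'I_N -> K) :
  \sum_i c i * (w i)%:Z = 1 -> (forall i, vge v 0 (f i)) ->
  vge v (1 - \sum_i (w i)%:Z) (jacobian f).
Proof.
move=> cw f0; pose X i : K := ('X_i)%:F.
pose M : 'M[K]_N := \matrix_(i, j) (X j * fderiv j (f i)).
have M1 : vge v 1 (\det M).
  apply: (vge_det_unimodular vM vD (w := fun j => (w j)%:R) (c := fun j => (c j)%:~R)).
  - by move=> i j; rewrite mxE; exact: vge_logderiv.
  - by move=> j; exact: vge_int.
  - rewrite -[RHS](rmorph1 (intmul (1 : K))) -cw rmorph_sum.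
    by apply: eq_bigr => j _; rewrite rmorphM.
  - move=> i; under eq_bigr do rewrite mxE; exact: vge_euler.
have detM : \det M = jacobian f * \prod_j X j.
  have -> : M = (\matrix_(i, j) fderiv j (f i)) *m diag_mx (\row_j X j).
    by apply/matrixP => i j; rewrite mul_mx_diag !mxE mulrC.
  rewrite det_mulmx det_diag; congr (_ * _).
  by apply: eq_bigr => j _; rewrite mxE.
have Xn0 : \prod_j X j != 0 by apply/prodf_neq0 => j _; exact: tofracX_neq0.
have vX : v (\prod_j X j) = \sum_i (w i)%:Z.
  have -> : \prod_j X j = lmon X (fun=> 1) by [].
  by rewrite wval_lmon; apply: eq_bigr => i _; rewrite mul1r.
have [->|j0] := eqVneq (jacobian f) 0; first exact: vge0.
move: M1; rewrite detM (vgeE v 1 (mulf_neq0 j0 Xn0)) (vM j0 Xn0) vX.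
by rewrite (vgeE v _ j0) lerBlDr.
Qed.

End LogDerivations.

Section ToricInvariants.
Variables (k : fieldType) (N : nat) (w : 'I_N -> nat) (c : 'I_N -> int).
Hypothesis cw : \sum_i c i * (w i)%:Z = 1.
Hypothesis w0 : forall i, (0 < w i)%N.
Local Notation K := (funfield k N).
Local Notation E := (toric_divisor k cw).

Lemma toric_pd_ord : pd_ord E = wval w. Proof. by []. Qed.

Lemma toric_center : center_is_origin E.
Proof.
have oE f : origin_ideal k N f = (f@_0%MM = 0).
  by rewrite /origin_ideal /= meval_origin.
have cE f : center_ideal E f = toric_prime w f%:F by [].
apply/seteqP; split=> f; rewrite cE oE.
  have [->|f0] := eqVneq f 0; first by rewrite mcoeff0.
  move=> [_]; rewrite vgeE ?tofrac_eq0// wval_tofrac// => f1.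
  have [+ _] := wordP w f0; apply; rewrite /wdot big1 => [|i _]; first by lia.
  by rewrite mnm0E muln0.
move=> f0; split; first exact: half_laurent_tofrac.
apply: (@vge_tofrac _ _ _ 1) => m; rewrite ltnS leqn0 => /eqP mw.
suff -> : m = 0%MM by [].
apply/eqP; rewrite -mdeg_eq0 -leqn0 -mw; exact: mdeg_le_wdot.
Qed.

Lemma toric_ordX i : pd_ord E ('X_i)%:F = (w i)%:Z.
Proof.
rewrite toric_pd_ord wval_tofrac ?mpolyX_neq0// wordX /wdot (bigD1 i)//= mnm1E eqxx muln1.
by rewrite big1 ?addn0// => j ji; rewrite mnm1E eq_sym (negPf ji) muln0.
Qed.

Lemma toric_discrepancy : discrepancy E = \sum_i (w i)%:Z - 1.
Proof.
apply/eqP; rewrite eq_le; apply/andP; split; last first.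
  rewrite lerBlDr; have := @sum_ord_le_discrepancy k N E.
  under eq_bigr do rewrite toric_ordX.
  by apply=> i; rewrite toric_ordX; exact: w0.
have [_ [f [Of j0 fE]]] := discrepancyP E.
have Of' i : vge (wval w) 0 (f i) by have /local_ringE := Of i.
have := vge_jacobian cw Of'; rewrite vgeE//.
have -> : wval w (jacobian f) = - discrepancy E by exact: fE.
by move: (\sum_i _) (discrepancy _) => *; lia.
Qed.

End ToricInvariants.

Section MonomialIdeals.
Variables (R : realType) (k : fieldType) (N : nat).
Implicit Types (I : set {mpoly k[N]}) (E : prime_divisor k N).

Definition exponent_set I : set 'X_{1..N} := [set m | I 'X_[m]].

Definition ord_weight E (i : 'I_N) : nat := absz (pd_ord E ('X_i)%:F).

Lemma ord_weightE E i : pd_ord E ('X_i)%:F = (ord_weight E i)%:Z.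
Proof. by rewrite /ord_weight gez0_abs//; exact: pd_ordX_ge0. Qed.

Lemma pd_ordXm E m : pd_ord E ('X_[m])%:F = (wdot (ord_weight E) m)%:Z.
Proof.
rewrite tofracX_lmon (val_lmon (@tofracX_neq0 k N) (@pd_ordM k N E)).
rewrite -[RHS]natz natr_sum; apply: eq_bigr => i _.
by rewrite natrM !natz mulrC ord_weightE.
Qed.

(** The polynomials all of whose monomials are multiples of generators form an ideal containing the
    generators, hence containing [I]. *)
Lemma monomial_ideal_msupp I f m : monomial_ideal I -> I f -> m \in msupp f ->
  exponent_set I m.
Proof.
move=> [M IE]; pose J : set {mpoly k[N]} :=
  [set f | forall m, m \in msupp f -> exists2 a, M a & (a <= m)%MM].
have Jideal : is_ideal J.
  split.
  - by move=> a; rewrite msupp0.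
  - by move=> a b Ja Jb l /msuppD_le; rewrite mem_cat => /orP[/Ja|/Jb].
  - move=> a b Jb l /msuppM_le /allpairsP[[l1 l2] [/= _ /Jb[u Mu ul] ->]].
    by exists u => //; apply: lepm_trans ul _; exact: lem_addl.
have MJ : [set 'X_[a] | a in M] `<=` J.
  move=> _ [a Ma <-] l; rewrite msuppX inE => /eqP ->.
  by exists a => //; exact: lepm_refl.
have Iideal : is_ideal I.
  rewrite IE; split.
  - by move=> A [[]].
  - by move=> f' g If Ig A [AI MA]; have [_ D _] := AI; apply: D; [exact: If|exact: Ig].
  - by move=> f' g Ig A [AI MA]; have [_ _ P] := AI; apply: P; exact: Ig.
move=> If mf; have : J f by move: If; rewrite IE; apply.
move=> /(_ m mf)[a Ma am]; rewrite /exponent_set /= -(submK am) mpolyXD.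
have [_ _ IM] := Iideal; apply: IM; rewrite IE => A [_]; apply.
by exists a.
Qed.

Lemma ideal_val_monomial I E g : monomial_ideal I ->
  least_weight (exponent_set I) g ->
  ideal_val R E I = ((g (ord_weight E))%:R)%:E.
Proof.
move=> mI /(_ (ord_weight E))[gle [m Im mE]].
have nX : 'X_[m] != 0 :> {mpoly k[N]} by exact: mpolyX_neq0.
have vE : ((pd_ord E ('X_[m])%:F)%:~R)%:E = ((g (ord_weight E))%:R)%:E :> \bar R.
  by rewrite pd_ordXm mE.
apply/eqP; rewrite eq_le; apply/andP; split.
  by rewrite -vE; apply: ereal_inf_lbound; exists 'X_[m] => //; split=> //; apply/eqP.
apply: le_ereal_inf_tmp => _ [f [If /eqP f0] <-]; rewrite lee_fin.
have F0 : f%:F != 0 :> funfield k N by rewrite tofrac_eq0.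
have : vge (pd_ord E) (g (ord_weight E))%:Z f%:F.
  rewrite [f]mpolyE rmorph_sum big_seq /=; apply: (vge_sum (@pd_ordD k N E)) => l lf.
  rewrite -mul_mpolyC tofracM -[Posz _]add0r; apply: (vgeM (@pd_ordM k N E)).
    exact/subalg_vge/gen_subalgC.
  rewrite vgeE ?tofrac_eq0 ?mpolyX_neq0// pd_ordXm lez_nat.
  by apply: gle; exact: monomial_ideal_msupp mI If lf.
by rewrite vgeE// -(ler_int R).
Qed.

Lemma ideal_val_zero I E : monomial_ideal I -> exponent_set I = set0 ->
  ideal_val R E I = +oo%E.
Proof.
move=> mI e; rewrite /ideal_val.
suff -> : I `\ 0 = set0 by rewrite image_set0 ereal_inf0.
rewrite -subset0 => f [If /eqP f0]; suff : exponent_set I (mlead f) by rewrite e.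
by apply: monomial_ideal_msupp mI If _; rewrite mlead_supp.
Qed.

End MonomialIdeals.

(** * Minimal log discrepancies of monomial pairs *)

Lemma bezout_family N (w : 'I_N -> int) :
  exists (d : int) (c : 'I_N -> int),
    [/\ 0 <= d, \sum_i c i * w i = d & forall i, exists q, w i = q * d].
Proof.
elim: N w => [|N IH] w; first by exists 0, (fun=> 0); rewrite big_ord0; split=> // -[].
have [d [c [_ cE dw]]] := IH (fun i => w (lift ord0 i)).
have [u [v uvE]] := Bezoutz (w ord0) d.
exists (gcdz (w ord0) d), (fun i => if unlift ord0 i is Some j then v * c j else u).
split; first by [].
  rewrite big_ord_recl unlift_none -uvE; congr (_ + _); rewrite -cE big_distrr.
  by apply: eq_bigr => i _ /=; rewrite liftK mulrA.
move=> i; case: (unliftP ord0 i) => [j ->|->].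
  have [q ->] := dw j; have /dvdzP[r rE] := dvdz_gcdr (w ord0) d.
  by exists (q * r); rewrite {1}rE mulrA.
by have /dvdzP[r rE] := dvdz_gcdl (w ord0) d; exists r.
Qed.

Lemma primitive_weight N (w : 'I_N -> nat) : (0 < N)%N -> (forall i, 0 < w i)%N ->
  exists (d : nat) (w' : 'I_N -> nat) (c : 'I_N -> int),
    [/\ (0 < d)%N, forall i, w i = (d * w' i)%N, forall i, (0 < w' i)%N
      & \sum_i c i * (w' i)%:Z = 1].
Proof.
move=> N0 w0; have [d [c [d0 cE dw]]] := bezout_family (fun i => (w i)%:Z).
have /boolp.choice[q qE] := dw.
have {d0}d0 : 0 < d.
  rewrite lt_neqAle d0 andbT eq_sym.
  apply: contraTneq (w0 (Ordinal N0)) => e.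
  by have := qE (Ordinal N0); rewrite e mulr0 => -[->].
have q0 i : 0 < q i.
  have : 0 < (w i)%:Z by rewrite ltz_nat.
  by rewrite qE pmulr_lgt0.
exists (absz d), (fun i => absz (q i)), c; split.
- by rewrite absz_gt0 gt_eqF.
- by move=> i; have := congr1 absz (qE i); rewrite abszM /= mulnC.
- by move=> i; rewrite absz_gt0 gt_eqF.
apply: (mulIf (lt0r_neq0 d0)); rewrite mul1r -[RHS]cE big_distrl.
by apply: eq_bigr => i _ /=; rewrite qE gtz0_abs// mulrA.
Qed.

Lemma wdotZ N (w w' : 'I_N -> nat) d m : (forall i, w i = d * w' i)%N ->
  wdot w m = (d * wdot w' m)%N.
Proof.
by move=> wE; rewrite /wdot big_distrr; apply: eq_bigr => i _ /=; rewrite wE mulnA.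
Qed.

Lemma least_weight_homo N (S : set 'X_{1..N}) g (w w' : 'I_N -> nat) :
  least_weight S g -> (forall i, w i <= w' i)%N -> (g w <= g w')%N.
Proof.
move=> gP ww; have [_ [m Sm <-]] := gP w'; have [gw _] := gP w.
by apply: leq_trans (gw _ Sm) _; apply: leq_sum => i _; rewrite leq_mul2r ww orbT.
Qed.

Lemma least_weightZ N (S : set 'X_{1..N}) g (w w' : 'I_N -> nat) d :
  least_weight S g -> (forall i, w i = d * w' i)%N -> g w = (d * g w')%N.
Proof.
move=> gP wE; have [gw [m Sm mE]] := gP w; have [gw' [m' Sm' mE']] := gP w'.
apply/eqP; rewrite eqn_leq -{1}mE' -(wdotZ _ wE) gw// -mE (wdotZ _ wE).
by rewrite leq_mul2l gw' ?orbT.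
Qed.

Lemma toric_logdiscZ (R : realType) N M (c : 'I_M -> R)
    (S : 'I_M -> set 'X_{1..N}) g (w w' : 'I_N -> nat) d :
  (forall j, least_weight (S j) (g j)) -> (forall i, w i = d * w' i)%N ->
  toric_logdisc c g w = d%:R * toric_logdisc c g w'.
Proof.
move=> gP wE; rewrite /toric_logdisc mulrBr mulr_sumr; congr (_ - _).
  by rewrite -natrM big_distrr; congr (_%:R); apply: eq_bigr => i _; rewrite wE.
by apply: eq_bigr => j _; rewrite (least_weightZ (gP j) wE) natrM mulrCA.
Qed.

(* If [w_1] divides [d], then [d w + e_0] is primitive: a prime factor of
   [d w_1] divides [d] hence not [d w_0 + 1]. *)
Lemma toric_logdisc_unbounded (R : realType) N M (c : 'I_M -> R)
    (S : 'I_M -> set 'X_{1..N}) g (w : 'I_N -> nat) (r : R) :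
  (1 < N)%N -> (forall j, 0 <= c j) -> (forall j, least_weight (S j) (g j)) ->
  (forall i, 0 < w i)%N -> toric_logdisc c g w < 0 ->
  exists (u : 'I_N -> nat) (b : 'I_N -> int),
    [/\ (forall i, 0 < u i)%N, \sum_i b i * (u i)%:Z = 1
      & toric_logdisc c g u <= r].
Proof.
move=> N1 c0 gP w0 Aw.
pose i0 : 'I_N := Ordinal (ltnW N1); pose i1 : 'I_N := Ordinal N1.
have i10 : (i1 == i0) = false by [].
have nA : 0 < - toric_logdisc c g w by rewrite oppr_gt0.
have [t t0 tP] : exists2 t : nat, (0 < t)%N &
    (1 - r) / - toric_logdisc c g w <= t%:R.
  have [neg|pos] := lerP ((1 - r) / - toric_logdisc c g w) 0.
    by exists 1%N => //; apply: le_trans neg _.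
  move: (archi_boundP (ltW pos)); move: (Num.bound _) => t lt.
  by exists t; [rewrite -(ltr_nat R); exact: lt_trans pos lt|exact: ltW].
pose d := (w i1 * t)%N; pose u i := (d * w i + (i == i0))%N.
(* The Bezout coefficients come from [1 = (1 - d w_0) (d w_0 + 1) + d^2 w_0^2], where
   [d^2 = t (d w_1)]. *)
exists u, (fun i => if i == i0 then 1 - (d * w i0)%N%:Z
  else if i == i1 then (t * w i0 ^ 2)%N%:Z else 0); split.
- by move=> i; rewrite /u addn_gt0 !muln_gt0 !w0 t0.
- rewrite (bigD1 i0)//= (bigD1 i1)//= big1 => [|i /andP[/negPf -> /negPf ->]]; last first.
    by rewrite mul0r.
  rewrite addr0 /u eqxx i10 addn0 /d !PoszD !PoszM.
  by rewrite -[Posz true]/(1 : int); move: (w i0) (w i1) => x y; ring.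
have dt : (t <= d)%N by rewrite /d leq_pmull.
(* Adding [e_0] raises the sum of the weights by one and lowers no order. *)
have Au : toric_logdisc c g u <= d%:R * toric_logdisc c g w + 1.
  rewrite /toric_logdisc /u big_split /= -big_distrr /= natrD natrM.
  have -> : (\sum_(i < N) (i == i0) = 1)%N.
    by rewrite (bigD1 i0)//= big1 => [|i /negPf ->].

  rewrite mulrBr -addrA [1 - _]addrC addrA lerD2r lerD2l lerN2 mulr_sumr.
  apply: ler_sum => j _; rewrite mulrCA ler_wpM2l// -natrM ler_nat.
  have h : forall i, (d * w i)%N = (d * w i)%N by [].
  rewrite -(least_weightZ (gP j) h); apply: (least_weight_homo (gP j)) => i.
  exact: leq_addr.
apply: (le_trans Au).
have : (1 - r) / - toric_logdisc c g w <= d%:R.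
  by apply: le_trans tP _; rewrite ler_nat.
by rewrite ler_pdivrMr//; lra.
Qed.

Section MonomialPairs.
Variables (R : realType) (k : fieldType) (N : nat).
Hypothesis N0 : (0 < N)%N.
Implicit Types (a : multiideal R k N) (E : prime_divisor k N).

Lemma center_ordX_gt0 E i : center_is_origin E -> 0 < pd_ord E ('X_i)%:F.
Proof.
move=> cE; apply: pd_ord_gt0; first exact: tofracX_neq0.
have : center_ideal E 'X_i by rewrite cE /origin_ideal /= mevalXU.
by [].
Qed.

Lemma ord_weight_gt0 E i : center_is_origin E -> (0 < ord_weight E i)%N.
Proof.
by move=> /(center_ordX_gt0 i) E0; rewrite /ord_weight absz_gt0 gt_eqF.
Qed.

Lemma ideal_val_ge0 E (I : set {mpoly k[N]}) : (0 <= ideal_val R E I)%E.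
Proof.
apply: le_ereal_inf_tmp => _ [f [If /eqP f0] <-].
have F0 : f%:F != 0 :> funfield k N by rewrite tofrac_eq0.
rewrite lee_fin ler0z -(vgeE _ _ F0).
apply: subalg_vge; rewrite [f]mpolyE rmorph_sum.
apply: (big_ind (gen_subalg (pd_gen (p := E)))).
- exact: gen_subalg0.
- by move=> x y; exact: gen_subalgD.
move=> m _ /=; rewrite -mul_mpolyC tofracM; apply: gen_subalgM.
  exact: gen_subalgC.
rewrite mpolyXE_id rmorph_prod; apply: (big_ind (gen_subalg (pd_gen (p := E)))).
- exact: gen_subalg1.
- by move=> x y; exact: gen_subalgM.
move=> i _ /=; rewrite tofracXn; apply: gen_subalgX; exact: pd_dominates.
Qed.

Lemma log_discrepancy_zero a i E : monomial_multiideal a ->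
  exponent_set (mi_ideal (m := a) i) = set0 -> log_discrepancy E a = -oo%E.
Proof.
move=> ma ai; rewrite /log_discrepancy.
suff -> : (\sum_i (mi_exp i)%:E * ideal_val R E (mi_ideal (m := a) i))%E = +oo%E by [].
rewrite (bigD1 i)//= (ideal_val_zero R E (ma i) ai).
rewrite gt0_muley ?lte_fin ?mi_exp_gt0// addye//.
suff : (0 <= \sum_(j < mi_size a | j != i)
  (mi_exp j)%:E * ideal_val R E (mi_ideal (m := a) j))%E by case: (\sum_(_ < _ | _) _)%E.
apply: sume_ge0 => j _; apply: mule_ge0; last exact: ideal_val_ge0.
by rewrite lee_fin ltW// mi_exp_gt0.
Qed.

Lemma log_discrepancyE a (g : 'I_(mi_size a) -> ('I_N -> nat) -> nat) E :
  monomial_multiideal a ->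
  (forall i, least_weight (exponent_set (mi_ideal (m := a) i)) (g i)) ->
  log_discrepancy E a = ((discrepancy E + 1)%:~R -
    \sum_i mi_exp (m := a) i * (g i (ord_weight E))%:R)%:E.
Proof.
move=> ma gP; rewrite /log_discrepancy.
under eq_bigr do rewrite (ideal_val_monomial R E (ma _) (gP _)) -EFinM.
by rewrite sumEFin -EFinB -EFinD intrD addrAC.
Qed.

(* [toric_form a c g]: up to merging equal exponents and removing unit ideals,
   [a] has exponents [c] and ideals with order functions [g]. *)
Definition toric_form a M (c : 'I_M -> R) (g : 'I_M -> ('I_N -> nat) -> nat) :=
  forall E, center_is_origin E -> log_discrepancy E a =
    ((discrepancy E + 1)%:~R - \sum_j c j * (g j (ord_weight E))%:R)%:E.

Section ToricForm.
Variables (a : multiideal R k N) (M : nat) (c : 'I_M -> R).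
Variables (S : 'I_M -> set 'X_{1..N}) (g : 'I_M -> ('I_N -> nat) -> nat).
Hypothesis aE : toric_form a c g.
Hypothesis gP : forall j, least_weight (S j) (g j).
Hypothesis c0 : forall j, 0 <= c j.

Lemma toric_logdisc_le E : center_is_origin E ->
  ((toric_logdisc c g (ord_weight E))%:E <= log_discrepancy E a)%E.
Proof.
move=> cE; rewrite (aE cE) lee_fin lerD2r.
have := sum_ord_le_discrepancy (fun i => center_ordX_gt0 i cE).
rewrite (eq_bigr _ (fun i _ => ord_weightE E i)).
have -> : \sum_i (ord_weight E i)%:Z = (\sum_i ord_weight E i)%N%:Z.
  by rewrite -[RHS]natz natr_sum; apply: eq_bigr => i _; rewrite natz.
by rewrite -(ler_int R).
Qed.

Lemma log_discrepancy_toric (w : 'I_N -> nat) b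
  (bw : \sum_i b i * (w i)%:Z = 1) : (forall i, 0 < w i)%N ->
  log_discrepancy (toric_divisor k bw) a = (toric_logdisc c g w)%:E.
Proof.
move=> w0; rewrite (aE (toric_center k bw w0)) (toric_discrepancy k bw w0) subrK.
have -> : ord_weight (toric_divisor k bw) = w.
  by apply/funext => i; rewrite /ord_weight toric_ordX.
have -> : \sum_i (w i)%:Z = (\sum_i w i)%N%:Z.
  by rewrite -[RHS]natz natr_sum; apply: eq_bigr => i _; rewrite natz.
by [].
Qed.

Lemma mld_le_log_discrepancy E : center_is_origin E -> (mld a <= log_discrepancy E a)%E.
Proof.
move=> cE; have le : (ereal_inf [set log_discrepancy E a
    | E in [set E : prime_divisor k N | center_is_origin E]] <= log_discrepancy E a)%E.
  by apply: ereal_inf_lbound; exists E.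
by rewrite /mld; case: ifP => // _; exact: leNye.
Qed.

(** A weight is a multiple [d w'] of a primitive one, and [A w = d A w' >= A w'] because [A] is
    nonnegative. *)
Lemma mld_le_toric (w : 'I_N -> nat) : (forall i, 0 < w i)%N ->
  (forall w, (forall i, 0 < w i)%N -> 0 <= toric_logdisc c g w) ->
  (mld a <= (toric_logdisc c g w)%:E)%E.
Proof.
move=> w0 A0; have [d [w' [b [d0 wE w'0 bw]]]] := primitive_weight N0 w0.
apply: le_trans (mld_le_log_discrepancy (toric_center k bw w'0)) _.
rewrite log_discrepancy_toric// lee_fin (toric_logdiscZ _ gP wE).
by rewrite ler_peMl ?A0// ler1n.
Qed.

Lemma mld_inf : (forall w, (forall i, 0 < w i)%N -> 0 <= toric_logdisc c g w) ->
  mld a = ereal_inf [set log_discrepancy E a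
    | E in [set E : prime_divisor k N | center_is_origin E]].
Proof.
move=> A0; rewrite /mld; case: ifP => // /andP[_]; rewrite ltNge => /negP[].
apply: le_ereal_inf_tmp => _ [E cE <-]; apply: le_trans (toric_logdisc_le cE).
by rewrite lee_fin; apply: A0 => i; exact: ord_weight_gt0.
Qed.

(** For [N = 1] a negative infimum is replaced by [-oo] in the definition. For [N > 1] the infimum
    itself is [-oo], by [toric_logdisc_unbounded]. *)
Lemma mld_eq_ninfty (w : 'I_N -> nat) : (forall i, 0 < w i)%N ->
  toric_logdisc c g w < 0 -> mld a = -oo%E.
Proof.
move=> w0 Aw; have [d [w' [b [d0 wE w'0 bw]]]] := primitive_weight N0 w0.
have Aw' : toric_logdisc c g w' < 0.
  by move: Aw; rewrite (toric_logdiscZ _ gP wE) pmulr_rlt0// ltr0n.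
have [N1|N1] := leqP N 1.
  rewrite /mld; have -> : (N == 1)%N by rewrite eqn_leq N1 N0.
  rewrite ifT//=; apply: (@le_lt_trans _ _ (toric_logdisc c g w')%:E).
    rewrite -(log_discrepancy_toric bw)//; apply: ereal_inf_lbound.
    by eexists; first exact: toric_center bw w'0.
  by rewrite lte_fin.
apply: eq_ninfty => r.
have [u [b' [u0 bu ur]]] := toric_logdisc_unbounded r N1 c0 gP w'0 Aw'.
apply: le_trans (mld_le_log_discrepancy (toric_center k bu u0)) _.
by rewrite log_discrepancy_toric.
Qed.

Lemma toric_computes_mld (w : 'I_N -> nat) b (bw : \sum_i b i * (w i)%:Z = 1) :
  (forall i, 0 < w i)%N ->
  toric_logdisc c g w < 0 \/
    (forall w', (forall i, 0 < w' i)%N -> 0 <= toric_logdisc c g w' /\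
      toric_logdisc c g w <= toric_logdisc c g w') ->
  computes_mld (toric_divisor k bw) a.
Proof.
move=> w0 [Aw|Amin]; split; [exact: toric_center|right|exact: toric_center|left].
  by rewrite (mld_eq_ninfty w0 Aw) log_discrepancy_toric// lte_fin.
have A0 w' w'0 := (Amin w' w'0).1.
have e : log_discrepancy (toric_divisor k bw) a = mld a.
  apply/eqP; rewrite eq_le mld_le_log_discrepancy ?andbT; last exact: toric_center.
  rewrite (mld_inf A0); apply: le_ereal_inf_tmp => _ [E cE <-].
  apply: le_trans (toric_logdisc_le cE).
  rewrite log_discrepancy_toric// lee_fin.
  by apply: (Amin _ _).2 => i; exact: ord_weight_gt0.
by split=> //; rewrite -e log_discrepancy_toric// lee_fin; exact: A0.
Qed.

End ToricForm.

End MonomialPairs.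

(** * Boundedness of discrepancies and the ascending chain condition *)

(** A monomial ideal without monomials is zero, and would make every log discrepancy [-oo]. *)
Lemma monomial_least_weights (R : realType) (k : fieldType) N
    (a : multiideal R k N) (E : prime_divisor k N) :
  monomial_multiideal a -> log_discrepancy E a <> -oo%E ->
  exists g, forall i, least_weight (exponent_set (mi_ideal (m := a) i)) (g i).
Proof.
move=> ma nE.
suff /boolp.choice[g gP] i : exists g,
  least_weight (exponent_set (mi_ideal (m := a) i)) g by exists g.
apply: least_weight_exists; apply/set0P/eqP => ai; apply: nE.
exact: log_discrepancy_zero ma ai.
Qed.

(** Multiideals with the same set of exponents may have any number of ideals. Merging equal
    exponents brings them all to one index type, over which limits can be taken. *)
Lemma toric_form_exponents (R : realType) (k : fieldType) N
    (a : multiideal R k N) (s : seq R)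
    (g : 'I_(mi_size a) -> ('I_N -> nat) -> nat) :
  exponents a = [set` s] -> uniq s -> monomial_multiideal a ->
  (forall i, least_weight (exponent_set (mi_ideal (m := a) i)) (g i)) ->
  toric_form a (fun j : 'I_(size s) => s`_j)
    (fun j w => \sum_(i | mi_exp (m := a) i == (s`_j)%R) g i w)%N.
Proof.
move=> es us ma gP E cE; rewrite (log_discrepancyE E ma gP); congr (_ - _)%:E.
under [RHS]eq_bigr do rewrite natr_sum mulr_sumr big_mkcond.
rewrite exchange_big; apply: eq_bigr => i _ /=.
have ei : mi_exp (m := a) i \in s.
  have : exponents a (mi_exp (m := a) i) by exists i.
  by rewrite es.
have lt : (index (mi_exp (m := a) i) s < size s)%N by rewrite index_mem.
rewrite (bigD1 (Ordinal lt))//= nth_index// eqxx big1 ?addr0// => j jne.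
case: eqP => // ej; case/eqP: jne; apply: val_inj => /=.
by rewrite ej index_uniq.
Qed.

Lemma dcc_setU1 (R : realType) (J : set R) x : dcc J -> dcc (J `|` [set x]).
Proof.
move=> dJ [u uP].
have dec n m : (n < m)%N -> u m < u n by apply: ltn_homo_dec => i; have [] := uP i.
have [[n un]|nx] := pselect (exists n, u n = x).
  apply: dJ; exists (fun i => u (n.+1 + i)%N) => i; split; last first.
    by rewrite addnS; have [] := uP (n.+1 + i)%N.
  have [[//|ux] _] := uP (n.+1 + i)%N.
  have := dec n (n.+1 + i)%N (leq_addr _ _).
  by rewrite un ux ltxx.
apply: dJ; exists u => i; have [[Ju|ux] lt] := uP i; first by split.
by case: nx; exists i.
Qed.

Lemma dcc_gt0_min (R : realType) (J : set R) : (forall x, J x -> 0 < x) ->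
  dcc J -> exists2 d, 0 < d & forall x, J x -> d <= x.
Proof.
move=> J0 dJ; have [[x0 Jx0]|nJ] := pselect (exists x, J x); last first.
  by exists 1 => // x Jx; case: nJ; exists x.
apply: contrapT => nd.
have [||u uP] := @descending_seq R J (fun y x => y < x).
- by exists x0.
- move=> x Jx; apply: contrapT => ny; apply: nd; exists x; first exact: J0.
  by move=> y Jy; rewrite leNgt; apply/negP => lt; apply: ny; exists y.
- by apply: dJ; exists u.
Qed.

Lemma sum_nth_widen (V : nmodType) (T : Type) (d : T) (s : seq T) M (F : T -> V) :
  F d = 0 -> (size s <= M)%N -> \sum_(j < M) F (nth d s j) = \sum_(x <- s) F x.
Proof.
move=> Fd sM; rewrite (big_nth d) big_mkord (big_ord_widen M (fun j => F (nth d s j)) sM).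
rewrite [RHS]big_mkcond; apply: eq_bigr => j _.
by case: ltnP => // sj; rewrite nth_default.
Qed.

(* Unit ideals contribute nothing; the others have order at least one along the
   blowup of the origin, so there are at most [N / d] of them if all exponents
   are at least [d]. *)
Lemma toric_form_bounded (R : realType) (k : fieldType) N (J : set R) (d : R) M
    (a : multiideal R k N) : (0 < N)%N -> 0 < d -> (forall x, J x -> d <= x) ->
  N%:R / d <= M%:R -> exponents a `<=` J -> monomial_multiideal a ->
  log_canonical_at_origin a ->
  exists (c : 'I_M -> R) (S : 'I_M -> set 'X_{1..N}) g,
    [/\ forall j, (J `|` [set 1]) (c j), forall j, c j <= N.+1%:R,
      forall j, least_weight (S j) (g j) & toric_form a c g].
Proof.
move=> N0 d0 Jd NM aJ ma lc.
(* The weight (1, ..., 1) is already primitive; the call supplies the Bezout coefficients from which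
   its toric divisor is built. *)
have [e [w1 [b1 [_ eE w10 bw1]]]] :=
  primitive_weight (w := fun=> 1%N) N0 (fun=> isT).
have w1E : w1 = fun=> 1%N.
  apply/funext => i; have := eE i => /esym/eqP; rewrite muln_eq1.
  by move=> /andP[_ /eqP].
have cE := toric_center k bw1 w10.
have lcE : (0 <= log_discrepancy (toric_divisor k bw1) a)%E.
  by apply: lc; rewrite /center_contains_origin cE.
have [g gP] : exists g, forall i, least_weight (exponent_set (mi_ideal (m := a) i)) (g i).
  apply: (monomial_least_weights (E := toric_divisor k bw1) ma) => e1.
  by move: lcE; rewrite e1.
have aE : toric_form a (mi_exp (m := a)) g.
  by move=> E _; exact: log_discrepancyE ma gP.
pose one : 'I_N -> nat := fun=> 1%N.
have sumN : \sum_i mi_exp (m := a) i * (g i one)%:R <= N%:R.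
  move: lcE; rewrite (log_discrepancy_toric aE bw1 w10) w1E lee_fin.
  by rewrite /toric_logdisc sum_nat_const card_ord muln1 subr_ge0.
pose l := [seq i <- enum 'I_(mi_size a) | g i one != 0%N].
have eJ i : J (mi_exp (m := a) i) by apply: aJ; exists i.
have e_ge0 i : 0 <= mi_exp (m := a) i by apply: ltW; exact: mi_exp_gt0.
have suml : \sum_(i <- l) mi_exp (m := a) i <= N%:R.
  apply: le_trans sumN; rewrite big_filter big_enum_cond /=.
  rewrite [leRHS](bigID (fun i => g i one != 0%N)) /= ler_wpDr//.
    by apply: sumr_ge0 => i _; rewrite mulr_ge0.
  by apply: ler_sum => i gi; rewrite ler_peMr// ler1n lt0n.
have sizel : (size l <= M)%N.
  rewrite -(ler_nat R); apply: le_trans NM; rewrite ler_pdivlMr// mulrC.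
  apply: le_trans suml; rewrite -sum1_size natr_sum mulr_sumr.
  by apply: ler_sum => i _; rewrite mulr1; exact: Jd.
have ul : uniq l by exact: filter_uniq (enum_uniq _).
have el i : i \in l -> mi_exp (m := a) i <= N.+1%:R.
  move=> il; apply: le_trans (_ : N%:R <= _); last by rewrite ler_nat.
  apply: le_trans suml; rewrite (bigD1_seq i il ul)/=.
  by rewrite lerDl sumr_ge0.
(* Order zero at (1, ..., 1) forces the ideal to contain the monomial 1, hence to have order zero
   along every weight. *)
have gl j w' : j \notin l -> g j w' = 0%N.
  rewrite mem_filter mem_enum andbT negbK => /eqP gj.
  have [_ [m Sm m0]] := gP j one; have [gle _] := gP j w'.
  have me : m = 0%MM.
    apply/eqP; rewrite -mdeg_eq0 -leqn0 -gj -m0; exact: mdeg_le_wdot.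
  apply/eqP; rewrite -leqn0 (leq_trans (gle m Sm))// me /wdot big1// => q _.
  by rewrite mnm0E muln0.
pose val i :=
  (mi_exp (m := a) i, (exponent_set (mi_ideal (m := a) i), g i)).
pose vals := [seq val i | i <- l].
(* Padding up to [M] entries by unit ideals with exponent 1, whence the point 1 added to [J]. The
   bound [N.+1] covers this exponent as well as the others, which are at most [N]. *)
pose dflt : R * (set 'X_{1..N} * (('I_N -> nat) -> nat)) := (1, ([set 0%MM], fun=> 0%N)).
have valP (P : R * (set 'X_{1..N} * (('I_N -> nat) -> nat)) -> Prop) : P dflt ->
    (forall i, i \in l -> P (val i)) ->
    forall j, P (nth dflt vals j).
  move=> Pd Pl j; have [lt|ge] := ltnP j (size l); last first.
    by rewrite nth_default// size_map.
  have [i0] : exists i0 : 'I_(mi_size a), i0 \in l.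
    by case: (l) lt => // i0 l' _; exists i0; rewrite mem_head.
  by move=> _; rewrite (nth_map i0)//; apply: Pl; exact: mem_nth.
exists (fun j => (nth dflt vals j).1), (fun j => (nth dflt vals j).2.1),
  (fun j => (nth dflt vals j).2.2); split.
- move=> j; apply: (valP (fun x => (J `|` [set 1]) x.1)) => [|i _].
    by right.
  by left; exact: eJ.
- by move=> j; apply: (valP (fun x => x.1 <= N.+1%:R)) => /= [|i /el//]; rewrite ler1n.
- move=> j; apply: (valP (fun x => least_weight x.2.1 x.2.2)) => [|i _] /=.
    exact: least_weight0.
  exact: gP.
move=> E cE'; rewrite (aE E cE'); congr (_ - _)%:E.
rewrite (@sum_nth_widen R _ dflt vals M (fun x => x.1 * (x.2.2 (ord_weight E))%:R)).
- rewrite big_map /= big_filter big_enum_cond /= [RHS]big_mkcond.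
  apply: eq_bigr => i _; case: ifPn => // gi; rewrite gl ?mulr0//.
  by rewrite mem_filter negb_and gi.
- by rewrite /= mulr0.
- by rewrite size_map.
Qed.

Lemma bounded_discrepancy (R : realType) (k : fieldType) N : (0 < N)%N ->
  forall e : set R, finite_set e -> (forall x, e x -> 0 < x) ->
  exists l : nat, (0 < l)%N /\
    forall a : multiideal R k N, exponents a = e -> monomial_multiideal a ->
      exists E : prime_divisor k N,
        computes_mld E a /\ discrepancy E <= l%:Z.
Proof.
move=> N0 e /finite_seqP[s0 e0] epos; set s := undup s0.
have es : e = [set` s] by rewrite e0; apply/seteqP; split=> x /=; rewrite mem_undup.
apply: contrapT => nl.
have sumE (w : 'I_N -> nat) : \sum_i (w i)%:Z = (\sum_i w i)%N%:Z.
  by rewrite -[RHS]natz natr_sum; apply: eq_bigr => i _; rewrite natz.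
have /boolp.choice[a aP] (n : nat) : exists a : multiideal R k N,
    [/\ exponents a = e, monomial_multiideal a &
    forall E, computes_mld E a -> (n%:Z < discrepancy E)].
  apply: contrapT => na; apply: nl; exists n.+1; split=> // a ea ma.
  apply: contrapT => nE; apply: na; exists a; split=> // E Ea.
  rewrite ltNge; apply/negP => le; apply: nE; exists E; split=> //.
  by apply: le_trans le _; rewrite lez_nat.
have [d [w1 [b1 [_ _ w10 bw1]]]] := primitive_weight (w := fun=> 1%N) N0 (fun=> isT).
pose E1 := toric_divisor k bw1.
(* If some ideal of a term is zero, all log discrepancies are [-oo] and [E1] computes the mld. As
   [E1] has discrepancy [L - 1], this cannot happen from the index [L] on. *)
pose L := (\sum_i w1 i)%N.
have gex n : exists g,
    forall i, least_weight (exponent_set (mi_ideal (m := a (L + n)%N) i)) (g i).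
  have [_ ma aE] := aP (L + n)%N.
  apply: (monomial_least_weights (E := E1) ma) => e1.
  have : computes_mld E1 (a (L + n)%N).
    split; first exact: toric_center; right; split; last by rewrite e1.
    have := mld_le_log_discrepancy (a (L + n)%N) (toric_center k bw1 w10).
    by rewrite e1 leeNy_eq => /eqP.
  by move=> /aE; rewrite toric_discrepancy// sumE -/L; lia.
pose g n := sval (cid (gex n)); have gP n := svalP (cid (gex n)).
pose h n (j : 'I_(size s)) (w : 'I_N -> nat) :=
  (\sum_(i | mi_exp (m := a (L + n)%N) i == (s`_j)%R) g n i w)%N.
have /boolp.choice[S SP] n : exists S, forall j, least_weight (S j) (h n j).
  suff /boolp.choice[S SP] j : exists S, least_weight S (h n j) by exists S.
  exact: (least_weight_sum _ _ (gP n)).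
have s0' (j : 'I_(size s)) : 0 < s`_j.
  by apply: epos; rewrite es /= mem_nth.
have [w w0 wP] := toric_logdisc_bounded_min s0' SP.
have [q [w' [b [q0 wE w'0 bw]]]] := primitive_weight N0 w0.
(* The divisor of [w'] has discrepancy [|w'| - 1], so computing the mld of a term of index at least
   [|w'|] contradicts the choice of [a]. *)
have [n ln nP] := wP (\sum_i w' i)%N.
have [ea ma aE] := aP (L + n)%N.
have form : toric_form (a (L + n)%N) (fun j : 'I_(size s) => s`_j) (h n).
  apply: toric_form_exponents; rewrite ?undup_uniq//.
  by rewrite ea es.
have AZ := toric_logdiscZ (fun j : 'I_(size s) => s`_j) (SP n) wE.
have : computes_mld (toric_divisor k bw) (a (L + n)%N).
  apply: (toric_computes_mld N0 form (SP n)) => //; first by move=> j; exact/ltW.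
  case: nP => [neg|nP]; [left|right].
    by move: neg; rewrite AZ pmulr_rlt0// ltr0n.
  move=> u u0; have [? le] := nP u u0; split=> //; apply: le_trans le.
  by rewrite AZ ler_peMl ?ler1n//; have [] := nP w' w'0.
by move=> /aE; rewrite toric_discrepancy// sumE; lia.
Qed.

Lemma mld_acc (R : realType) (k : fieldType) N (J : set R) : (0 < N)%N ->
  (forall x, J x -> 0 < x) -> dcc J ->
  acc [set mld a | a in [set a : multiideal R k N |
            [/\ exponents a `<=` J, monomial_multiideal a
              & log_canonical_at_origin a]]].
Proof.
move=> N0 J0 dJ [u uP].
have [d d0 Jd] := dcc_gt0_min J0 dJ.
pose M := Num.bound (N%:R / d : R).
have NM : N%:R / d <= M%:R by apply/ltW/archi_boundP; rewrite divr_ge0// ltW.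
have /boolp.choice[a aP] n : exists a : multiideal R k N, [/\ exponents a `<=` J,
    monomial_multiideal a, log_canonical_at_origin a & mld a = u n].
  by have [[a [a1 a2 a3] a4] _] := uP n; exists a.
have /boolp.choice[c /boolp.choice[S /boolp.choice[g F]]] n :
    exists (c : 'I_M -> R) (S : 'I_M -> set 'X_{1..N}) g,
    [/\ forall j, (J `|` [set 1]) (c j), forall j, c j <= N.+1%:R,
      forall j, least_weight (S j) (g j) & toric_form (a n) c g].
  have [a1 a2 a3 _] := aP n; exact: toric_form_bounded N0 d0 Jd NM a1 a2 a3.
have J1 x : (J `|` [set 1]) x -> 0 < x by move=> [/J0//|->].
have cJ n j : (J `|` [set 1]) (c n j) by have [] := F n.
have cN n j : c n j <= N.+1%:R by have [_ h _ _] := F n; exact: h.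
have gP n j : least_weight (S n j) (g n j) by have [_ _ h _] := F n; exact: h.
have aE n : toric_form (a n) (c n) (g n) by have [] := F n.
have A0 n w : (forall i, 0 < w i)%N -> 0 <= toric_logdisc (c n) (g n) w.
  move=> w0; have [q [w' [b [q0 wE w'0 bw]]]] := primitive_weight N0 w0.
  rewrite (toric_logdiscZ _ (gP n) wE) mulr_ge0// -lee_fin.
  rewrite -(log_discrepancy_toric (aE n) bw w'0).
  have [_ _ lc _] := aP n; apply: lc.
  by rewrite /center_contains_origin (toric_center k bw w'0).
have [n nP] := toric_logdisc_acc J1 (dcc_setU1 dJ) cJ cN gP A0.
(* The strict inequality [u n < u n.+1] leaves room for a divisor whose log discrepancy on the
   [n]-th pair is below the next mld. *)
have [E cE Elt] : exists2 E : prime_divisor k N, center_is_origin E &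
    (log_discrepancy E (a n) < u n.+1)%E.
  have [_ lt] := uP n; have [_ _ _ un] := aP n.
  move: lt; rewrite -un (mld_inf (aE n) (A0 n)) => /ereal_inf_lt[_ [E cE <-] lt].
  by exists E.
have w0 i := ord_weight_gt0 i cE; set w := ord_weight E in w0.
have Aw : ((toric_logdisc (c n) (g n) w)%:E < u n.+1)%E.
  have h := toric_logdisc_le (aE n) cE.
  exact: le_lt_trans h Elt.
have ule m : (u m <= (toric_logdisc (c m) (g m) w)%:E)%E.
  have [_ _ _ <-] := aP m; exact: (mld_le_toric N0 (aE m) (gP m) w0 (A0 m)).
have [r rE] : exists r, u n.+1 = r%:E.
  by move: Aw (ule n.+1); case: (u n.+1) => [r _ _||]//; exists r.
move: Aw; rewrite rE lte_fin => Aw.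
(* Half of the gap: a late term [m] then has [u m] at most [A_n w] plus half the gap, hence below
   [u n.+1], although the sequence increases. *)
have eps0 : 0 < (r - toric_logdisc (c n) (g n) w) / 2.
  by rewrite divr_gt0// subr_gt0.
have [m nm le] := nP w w0 _ n.+1 eps0.
have uinc : (r%:E <= u m)%E.
  rewrite -rE; elim: m nm {le} => // m IH; rewrite leq_eqVlt => /orP[/eqP->//|].
  by rewrite ltnS => /IH le; apply: le_trans le (ltW _); have [] := uP m.
have := le_trans uinc (ule m); rewrite lee_fin => h.
by have := le_trans h le; lra.
Qed.

Theorem corollary1p10 (R : realType) (k : closedFieldType) (p : nat)
    (hp : p \in [pchar k]) (N : nat) (hN : (1 <= N)%N) :
  (forall e : set R, finite_set e -> (forall x, e x -> 0 < x) ->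
     exists l : nat, (0 < l)%N /\
       forall a : multiideal R k N, exponents a = e -> monomial_multiideal a ->
         exists E : prime_divisor k N,
           computes_mld E a /\ discrepancy E <= l%:Z) /\
  (forall J : set R, (forall x, J x -> 0 < x) -> dcc J ->
     acc [set mld a | a in [set a : multiideal R k N |
            [/\ exponents a `<=` J, monomial_multiideal a
              & log_canonical_at_origin a]]]).
Proof. by split=> [|J]; [exact: bounded_discrepancy|exact: mld_acc]. Qed.
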